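(* For each integer $i\ge -1$ and every $n\ge 1$, the number of maximal chains of length $n+i$ in the Tamari lattice $\mathcal{T}_n$ is $$\#\mathcal{C}_i(n)=\sum_{t=1}^{2i+3}\binom{n+i}{t+i}\,\#\mathcal{N}_i(t),$$ and this is a polynomial in $n$ of degree $3i+3$. The initial values $\#\mathcal{N}_i(n)$, $n\in[2i+3]$, are given by $$\#\mathcal{N}_i(n)=\sum_{t=1}^{n}(-1)^{n-t}\binom{n+i}{t+i}\,\#\mathcal{C}_i(t).$$
   Context: Young diagrams use English notation: a Young diagram of shape $\lambda=(\lambda_1\ge\lambda_2\ge\cdots)$ has $\lambda_j$ left-justified boxes in row $j$; rows are indexed $1,2,\dots$ from top to bottom, columns $1,2,\dots$ from left to right; $(x,y)$ is the box in row $x$, column $y$; the null diagram $\emptyset$ has no boxes. Set $\lambda_j=0$ for rows beyond the last nonempty row and $\lambda_0=+\infty$. Let $\delta_m=(m,m-1,\dots,1)$ for $m\ge1$, $\delta_m=\emptyset$ for $m\le 0$, $[m]=\{1,\dots,m\}$, $[0]=\emptyset$. For a Young diagram $Y$ and $d\ge1$, the height of the prime path of row $d$ of $Y$ is $h_Y(d)=\min\{h\ge1:\lambda_{d-h}\ge\lambda_d+h\}$ (the height of the prime Dyck subpath beginning at the north step at the end of row $d$ on the Dyck path tracing the boundary of $Y$). If $B$ is the last box of row $x_B$, the $B$-strip is the set of last boxes of rows $x_B-h_Y(x_B)+1,\dots,x_B$. $B$ is a corner box if it is the last box of its row and the lowest box of its column. $Y'$ covers $Y$ ($Y'\gtrdot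 Y$) if $Y'$ is obtained from $Y$ by deleting the $B$-strip of some corner box $B$ of $Y$. The Tamari lattice $\mathcal{T}_n$ is the set of Young diagrams contained in $\delta_{n-1}$ ordered by the reflexive-transitive closure of this covering relation (maximum $\emptyset$, minimum $\delta_{n-1}$); a maximal chain is $\emptyset=Y_0\gtrdot Y_1\gtrdot\cdots\gtrdot Y_l=\delta_{n-1}$, of length $l$. A tableau $T$ is a filling of a Young diagram with positive integers, strictly increasing along rows (left to right), weakly increasing down columns, with label set exactly $[l]$; $l=l(T)$ is its length, $T(x,y)$ the label of $(x,y)$. The $r$-set is the set of boxes labelled $r$; $T^{(r)}$ is the tableau of boxes with labels $\le r$. The end-box of a nonempty set of boxes is its box in the row of largest index. A $\psi$-tableau is a tableau $T$ with $sh(T^{(r-1)})\gtrdot sh(T^{(r)})$ for all $r\in[l(T)]$; it encodes the saturated chain $\emptyset=sh(T^{(0)})\gtrdot\cdots\gtrdot sh(T)$, and maximal chains of $\mathcal T_n$ of length $l$ correspond bijectively to $\psi$-tableaux of shape $\delta_{n-1}$ and length $l$. For a $\psi$-tableau $C$ of shape $\delta_{n-1}$, the outer diagonal is $\{(k,n-k):k\in[n-1]\}$. The $r$-set is a full-set if it contains a box of row 1 and its end-box lies in the outer diagonal, say at $(k,n-k)$; it is a plus-full-set ($r^+$-full-set) if moreover $k=n-1$, or $k\le n-2$ and $C(k+1,n-k-1)<r$. For $i\ge-1$, $\mathcal{C}_i(n)$ is the set of $\psi$-tableaux of shape $\delta_{n-1}$ and length $n+i$ (the maximal chains of $\mathcal{T}_n$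 of length $n+i$), and $\mathcal{N}_i(n)$ is the set of $C\in\mathcal C_i(n)$ with no plus-full-set. Binomial coefficients $\binom{a}{b}$ with $b>a\ge0$ are $0$. *)

(* Defs.v *)
From HB Require Import structures.
From mathcomp Require Import all_boot all_order all_algebra.

Set Implicit Arguments.
Unset Strict Implicit.
Unset Printing Implicit Defensive.

(* A Young diagram is the sequence of its nonzero row lengths, from top to
   bottom.  Rows and columns are numbered from 1. *)
Definition young (Y : seq nat) : bool := sorted geq Y && (0 \notin Y).

(* The length of row d >= 1, equal to 0 below the last nonempty row.  The value
   at d = 0 is junk: the convention that row 0 is infinite is made explicit
   in [height]. *)
Definition row_len (Y : seq nat) (d : nat) : nat := nth 0 Y d.-1.

Definition contained (Y Z : seq nat) : bool :=
  all (fun d => row_len Y d <= row_len Z d) (iota 1 (size Y)).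

Definition delta (m : nat) : seq nat := rev (iota 1 m).

(* The least h >= 1 such that lambda_(d-h) >= lambda_d + h; as row 0 is infinite,
   h = d always qualifies. *)
Definition height (Y : seq nat) (d : nat) : nat :=
  head d [seq h <- iota 1 d |
           (h == d) || (row_len Y d + h <= row_len Y (d - h))].

(* The last box of row x is the lowest box of its column. *)
Definition corner (Y : seq nat) (x : nat) : bool :=
  (0 < x <= size Y) && (row_len Y x.+1 < row_len Y x).

(* Removal of the last boxes of rows x - height Y x + 1, ..., x. *)
Definition delete_strip (Y : seq nat) (x : nat) : seq nat :=
  [seq k <- [seq row_len Y d - (x - height Y x < d <= x) | d <- iota 1 (size Y)]
  | k != 0].

(* [covers Y' Y] : Y' is an upper cover of Y. *)
Definition covers (Y' Y : seq nat) : bool :=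
  has (fun x => corner Y x && (Y' == delete_strip Y x)) (iota 1 (size Y)).

(* The elements of the Tamari lattice T_n. *)
Definition tamari (n : nat) (Y : seq nat) : bool :=
  young Y && contained Y (delta n.-1).

Definition maximal_chain (n : nat) (c : seq (seq nat)) : bool :=
  if c is Y0 :: c' then
    [&& all (tamari n) c, Y0 == [::], path covers Y0 c'
      & last Y0 c' == delta n.-1]
  else false.

(* A tableau is the sequence of its rows. *)
Definition shape (T : seq (seq nat)) : seq nat := map size T.

(* The label of the box (x, y), with x, y >= 1. *)
Definition label (T : seq (seq nat)) (x y : nat) : nat :=
  nth 0 (nth [::] T x.-1) y.-1.

Definition boxes (T : seq (seq nat)) : seq (nat * nat) :=
  [seq (x, y) | x <- iota 1 (size T), y <- iota 1 (row_len (shape T) x)].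

Definition tableau (l : nat) (T : seq (seq nat)) : bool :=
  [&& young (shape T),
      all (sorted ltn) T,
      all (fun b => ((b.1.+1, b.2) \in boxes T) ==>
                    (label T b.1 b.2 <= label T b.1.+1 b.2)) (boxes T)
    & perm_eq (undup (flatten T)) (iota 1 l)].

(* The tableau of the boxes with labels at most r. *)
Definition restrict (T : seq (seq nat)) (r : nat) : seq (seq nat) :=
  [seq R <- [seq [seq a <- R | a <= r] | R <- T] | R != [::]].

Definition psi_tableau (l : nat) (T : seq (seq nat)) : bool :=
  tableau l T &&
  all (fun r => covers (shape (restrict T r.-1)) (shape (restrict T r)))
      (iota 1 l).

Definition label_set (T : seq (seq nat)) (r : nat) : seq (nat * nat) :=
  [seq b <- boxes T | label T b.1 b.2 == r].

Definition is_end_box (b : nat * nat) (S : seq (nat * nat)) : bool :=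
  (b \in S) && all (fun b' => b'.1 <= b.1) S.

(* The r-set of T, of shape delta (n - 1), is a full-set with end-box at
   (k, n - k). *)
Definition full_set_at (n : nat) (T : seq (seq nat)) (r k : nat) : bool :=
  has (fun b => b.1 == 1) (label_set T r) &&
  is_end_box (k, n - k) (label_set T r).

Definition plus_full_set (n : nat) (T : seq (seq nat)) (r : nat) : bool :=
  has (fun k => full_set_at n T r k &&
                ((k == n.-1) || ((k <= n - 2) && (label T k.+1 (n - k - 1) < r))))
      (iota 1 n.-1).

(* Finite ambient types, used only to count.  A diagram contained in
   delta (n - 1) has at most n rows, of lengths < n, when n >= 1; likewise a
   tableau of shape delta (n - 1) with labels in [l] has at most n rows of
   length at most n. *)
Definition diagram_val n (Y : {bseq n of 'I_n}) : seq nat :=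
  [seq val k | k <- val Y].

Definition tableau_val n l (T : {bseq n of {bseq n of 'I_l.+1}})
    : seq (seq nat) :=
  [seq [seq val a | a <- val R] | R <- val T].

Definition maximal_chains (n l : nat) : {set l.+1.-tuple {bseq n of 'I_n}} :=
  [set c | maximal_chain n [seq diagram_val Y | Y <- val c]].

(* The natural number n + i; only meaningful when n + i >= 0. *)
Definition addni (n : nat) (i : int) : nat := absz (n%:Z + i)%R.

Definition Cset (i : int) (n : nat)
    : {set {bseq n of {bseq n of 'I_(addni n i).+1}}} :=
  [set T | psi_tableau (addni n i) (tableau_val T)
           && (shape (tableau_val T) == delta n.-1)].

Definition Nset (i : int) (n : nat)
    : {set {bseq n of {bseq n of 'I_(addni n i).+1}}} :=
  [set T in Cset i n |
    all (fun r => ~~ plus_full_set n (tableau_val T) r) (iota 1 (addni n i))].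

(* Main.v *)
Require Import Defs.
From HB Require Import structures.
From mathcomp Require Import all_boot all_order all_algebra.
From mathcomp Require Import zify ring.
Set Implicit Arguments.
Unset Strict Implicit.
Unset Printing Implicit Defensive.

(* Encode a diagram by e(d) = (length of row d) + d.  Going down the Tamari
   lattice then adds 1 to e on a strip of consecutive rows ending at some row b,
   those reached upwards from b before meeting a row c with e(c) >= e(b), and the
   step is allowed when that blocking row has e(c) > e(b).  A maximal chain is
   thus a word of end rows, leading from e(d) = d to e constant.

   Removing a plus-full-set with end-box in row k leaves rows k and k + 1 equal
   at every earlier time, so one of them can be dropped.  Conversely, at any
   moment of a chain there is a unique way to duplicate a row and insert a
   plus-full-set: k must be the first row that has reached its final length.
   The other plus-full-sets are unaffected, so that
   (p + 1) a(n + 1, p + 1) = (n + i + 1) a(n, p), where a(n, p) counts the elements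
   of C_i(n) with p plus-full-sets; this gives the binomial formula.

   Without plus-full-sets, the number of pairs of consecutive completed rows plus
   twice the length of row 1 grows by at most 2 at each step, whence
   N_i(n) is empty for n > 2i + 3; a zigzag word shows that N_i(2i + 3) is not. *)

(* [shape] alone would denote [seq.shape]. *)
Local Notation shape := Defs.shape.

(** * Strips and insertion of a row *)

(* Throughout, rows are numbered from 0 and [e d] is the length of row [d] plus
   [d].  [strip e b d]: row [d] belongs to the strip that ends at row [b]. *)
Definition strip (e : nat -> nat) (b d : nat) : bool :=
  (d <= b) && all (fun c => e c < e b) (iota d (b - d)).

Definition step (e : nat -> nat) (b d : nat) : nat := e d + strip e b d.

(* For a row [a] above [b], [strip e b a.+1] says that no row strictly between
   [a] and [b] blocks the strip. *)
Definition legal (e : nat -> nat) (b : nat) : bool :=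
  all (fun a => strip e b a.+1 ==> (e a != e b)) (iota 0 b).

Fixpoint valid (e : nat -> nat) (w : seq nat) : bool :=
  if w is b :: w' then legal e b && valid (step e b) w' else true.

Definition run (e : nat -> nat) (w : seq nat) : nat -> nat := foldl step e w.

Arguments run : simpl never.

Lemma stripP e b d :
  reflect (d <= b /\ forall c, d <= c < b -> e c < e b) (strip e b d).
Proof.
apply: (iffP andP) => -[db H]; split=> //.
  by move=> c cdb; apply: (allP H); rewrite mem_iota; lia.
by apply/allP=> c; rewrite mem_iota => cdb; apply: H; lia.
Qed.

Lemma stripbb e b : strip e b b.
Proof. by apply/stripP; split=> // c; lia. Qed.

Lemma legalP e b :
  reflect (forall a, a < b -> strip e b a.+1 -> e a <> e b) (legal e b).
Proof.
apply: (iffP allP) => H a.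
  by move=> ab; have /(_ a) := H; rewrite mem_iota ab => /(_ isT)/implyP s /s/eqP.
by rewrite mem_iota => ab; apply/implyP => s; apply/eqP; apply: H s.
Qed.

(** Going up from row [b], the first row with [e c >= e b] cannot have [e c = e b] by legality. So
    the strip either reaches [d] or is stopped by a strictly larger row. *)
Lemma legal_blocked e b d : legal e b -> d <= b ->
  strip e b d \/ exists2 c, d <= c < b & e b < e c.
Proof.
move=> /legalP lb; move Ej: (b - d) => j; elim: j d Ej => [|j IH] d Ej db.
  by left; rewrite (_ : d = b) ?stripbb //; lia.
case: (IH d.+1 ltac:(lia) ltac:(lia)) => [s|[c cP ec]]; last by right; exists c => //; lia.
have ne := lb d ltac:(lia) s.
case: (ltnP (e d) (e b)) => [ed|ed]; last by right; exists d; lia.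
left; apply/stripP; split=> // c cP; have [->//|nd] := eqVneq c d.
by have /stripP[_ H] := s; apply: H; lia.
Qed.

Lemma eq_strip e1 e2 b : e1 =1 e2 -> strip e1 b =1 strip e2 b.
Proof. by move=> E d; rewrite /strip; congr (_ && _); apply: eq_all => c; rewrite !E. Qed.

Lemma eq_step e1 e2 b : e1 =1 e2 -> step e1 b =1 step e2 b.
Proof. by move=> E d; rewrite /step E (eq_strip b E). Qed.

Lemma eq_legal e1 e2 b : e1 =1 e2 -> legal e1 b = legal e2 b.
Proof. by move=> E; apply: eq_all => a; rewrite !E (eq_strip b E). Qed.

Lemma eq_valid e1 e2 w : e1 =1 e2 -> valid e1 w = valid e2 w.
Proof.
elim: w e1 e2 => //= b w IH e1 e2 E.
by rewrite (eq_legal b E) (IH _ _ (eq_step b E)).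
Qed.

Lemma eq_run e1 e2 w : e1 =1 e2 -> run e1 w =1 run e2 w.
Proof. by rewrite /run; elim: w e1 e2 => //= b w IH e1 e2 E; apply/IH/eq_step. Qed.

Lemma valid_cat e u v : valid e (u ++ v) = valid e u && valid (run e u) v.
Proof. by elim: u e => //= b u IH e; rewrite IH andbA. Qed.

Lemma run_cat e u v : run e (u ++ v) = run (run e u) v.
Proof. exact: foldl_cat. Qed.

Lemma run_ge e w d : e d <= run e w d.
Proof. by rewrite /run; elim: w e => //= b w IH e; apply: leq_trans (IH _); rewrite leq_addr. Qed.

Lemma strip_gt e b d : b < d -> strip e b d = false.
Proof. by move=> bd; apply/stripP => -[]; lia. Qed.

Lemma run_out e w m d : all (fun b => b < m) w -> m <= d -> run e w d = e d.
Proof.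
move=> wm md; rewrite /run; elim: w e wm => //= b w IH e /andP[bm wm].
by rewrite IH // /step strip_gt ?addn0 //; lia.
Qed.

(* Row lengths are weakly decreasing. *)
Definition flat (e : nat -> nat) := forall d, e d.+1 <= (e d).+1.

(** The only dangerous case is [d.+1] in the strip and [d] outside. Then row [d] blocks, so
    [e d.+1 <= e b <= e d], which leaves room for the new box. *)
Lemma flat_step e b : flat e -> flat (step e b).
Proof.
move=> fe d; have := fe d; rewrite /step.
case: (boolP (strip e b d)) => /= [_|/stripP s]; first by case: strip; lia.
case: stripP => /= [[db H]|]; last by lia.
have : e b <= e d.
  rewrite leqNgt; apply/negP => lt; apply: s; split=> [|c cP]; first lia.
  by have [->//|nd] := eqVneq c d; apply: H; lia.
have [->|nb] := eqVneq d.+1 b; first lia.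
by have := H d.+1; lia.
Qed.

Lemma flat_run e w : flat e -> flat (run e w).
Proof. by rewrite /run; elim: w e => //= b w IH e fe; apply/IH/flat_step. Qed.

(** * Records, and how steps act on a duplicated row *)

Definition record (k : nat) (e : nat -> nat) := forall d, d < k -> e d < e k.

(* A row [c < k] with [e c >= e k] can never be overtaken by row [k]. *)
Lemma record_step k e b : legal e b -> record k (step e b) -> record k e.
Proof.
move=> lb rk d dk; have := rk d dk; rewrite /step.
case: (boolP (strip e b k)) => /= [sk|_]; last by lia.
case: (boolP (strip e b d)) => /= [_|sd]; first lia.
have /stripP[kb Hk] := sk.
case: (@legal_blocked e b d lb ltac:(lia)) => [s|[c cP ec]]; first by rewrite s in sd.
have ck : c < k by rewrite ltnNge; apply/negP => kc; have := Hk c; lia.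
have := rk c ck; rewrite /step sk /=.
have [->|nb] := eqVneq k b; first lia.
by have := Hk k; lia.
Qed.

Lemma record_run k e w : valid e w -> record k (run e w) -> record k e.
Proof.
rewrite /run; elim: w e => //= b w IH e /andP[lb vw] r.
by apply: (record_step lb); apply: IH vw r.
Qed.

(* The states before and after an inserted plus-full-set ending in row [k]: row [k]
   is duplicated, and afterwards the rows up to [k] are one box longer. *)
Definition dup (k : nat) (e : nat -> nat) (d : nat) : nat :=
  if d <= k then e d else (e d.-1).+1.

Definition lift_all (k : nat) (e : nat -> nat) (d : nat) : nat :=
  if d <= k then (e d).+1 else (e d.-1).+1.

Lemma dupL k e d : d <= k -> dup k e d = e d.
Proof. by rewrite /dup => ->. Qed.

Lemma dupR k e d : k <= d -> dup k e d.+1 = (e d).+1.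
Proof. by move=> kd; rewrite /dup ltnNge kd. Qed.

Lemma lift_allL k e d : d <= k -> lift_all k e d = (e d).+1.
Proof. by rewrite /lift_all => ->. Qed.

Lemma lift_allR k e d : k <= d -> lift_all k e d.+1 = (e d).+1.
Proof. by move=> kd; rewrite /lift_all ltnNge kd. Qed.

Lemma bumpL k b : b < k -> bump k b = b.
Proof. by rewrite /bump ltnNge => /negbTE->. Qed.

Lemma bumpR k b : k <= b -> bump k b = b.+1.
Proof. by rewrite /bump => ->. Qed.

(** For [k <= b] the target is raised by one while the rows up to [k] are not, which might let a row
    with [e c = e b] pass. The record at [k] excludes this: either [k = b], or the strip passes row
    [k] and [e c < e k < e b]. *)
Lemma strip_dupL k e b d : record k e -> d <= k ->
  strip (dup k e) (bump k b) d = strip e b d.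
Proof.
move=> rk dk; case: (leqP k b) => [kb|bk]; [rewrite bumpR // | rewrite bumpL //].
  apply/stripP/stripP => -[db H]; split=> [|c cP]; [lia| |lia|].
    case: (ltnP c k) => ck; last by have := H c.+1; rewrite !dupR //; lia.
    have [<-|kb'] := eqVneq k b; first exact: rk.
    by have := rk c ck; have := H k.+1; rewrite !dupR //; lia.
  rewrite dupR //; case: (leqP c k) => ck; last first.
    by case: c cP ck => // c cP ck; have := H c; rewrite dupR //; lia.
  rewrite dupL //; have [->//|nb] := eqVneq c b.
  by have := H c; lia.
by apply/stripP/stripP => -[db H]; split=> [|c cP]; try lia;
   have := H c; rewrite !dupL //; lia.
Qed.

Lemma strip_dupR k e b d : k <= d ->
  strip (dup k e) (bump k b) d.+1 = strip e b d.
Proof.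
move=> kd; case: (leqP k b) => [kb|bk]; [rewrite bumpR // | rewrite bumpL //]; last first.
  by rewrite !strip_gt //; lia.
apply/stripP/stripP => -[db H]; split=> [|c cP]; try lia.
  by have := H c.+1; rewrite !dupR //; lia.
by case: c cP => // c cP; have := H c; rewrite !dupR //; lia.
Qed.

(** [bump k] sends the end row [k] to the lower of the two copies, so both copies always move
    together. *)
Lemma step_dup k e b : record k e ->
  step (dup k e) (bump k b) =1 dup k (step e b).
Proof.
move=> rk d; case: (leqP d k) => dk; first by rewrite /step strip_dupL // !dupL.
by case: d dk => // d dk; rewrite /step strip_dupR // !dupR.
Qed.

(** If [a < k <= b] and the strip of [b] extends to row [a.+1], then [e a < e k <= e b], so legality
    can only fail at rows that are shifted together with [b]. *)
Lemma legal_dup k e b : record k e -> legal (dup k e) (bump k b) = legal e b.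
Proof.
move=> rk; case: (leqP k b) => [kb|bk]; last first.
  rewrite bumpL //; apply/legalP/legalP => H a ab.
    by have := H a ab; rewrite -{1}(bumpL bk) strip_dupL ?dupL //; lia.
  by rewrite -{1}(bumpL bk) strip_dupL ?dupL //; [apply: H|lia..].
apply/legalP/legalP => H a ab s.
  case: (leqP k a) => ka.
    by have := H a.+1; rewrite strip_dupR ?bumpR ?dupR //; [lia|lia].
  have := rk a ka; have /stripP[_ Hs] := s.
  by have [->|nb] := eqVneq k b; [lia|have := Hs k; lia].
have [ak|ak] := leqP a k; last first.
  case: a ak ab s => // a ka ab; rewrite strip_dupR ?(ltnW ka) // bumpR // !dupR //.
  by move=> /H; rewrite bumpR // in ab; lia.
rewrite bumpR // dupR // dupL //.
have [eak|nak] := eqVneq a k.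
  subst a; rewrite strip_dupR // in s; have /stripP[_ Hs] := s.
  by have [->|nb] := eqVneq k b; [lia|have := Hs k; lia].
rewrite strip_dupL // in s; last lia.
have /stripP[_ Hs] := s; have := rk a.
by have [->|nb] := eqVneq k b; [lia|have := Hs k; lia].
Qed.

(** All values are raised by one, so comparisons do not change. As [e b <= e k], a strip from below
    row [k] never passes row [k], nor its lower copy after lifting. *)
Lemma strip_liftL k e b d : e b <= e k -> b != k -> d <= k ->
  strip (lift_all k e) (bump k b) d = strip e b d.
Proof.
move=> ebk nbk dk; case: (leqP k b) => [kb|bk]; [rewrite bumpR // | rewrite bumpL //].
  apply/stripP/stripP => -[db H]; have := H k; last lia.
  by rewrite lift_allL // lift_allR //; lia.
by apply/stripP/stripP => -[db H]; split=> [|c cP]; try lia;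
   have := H c; rewrite !lift_allL //; lia.
Qed.

Lemma strip_liftR k e b d : k <= d ->
  strip (lift_all k e) (bump k b) d.+1 = strip e b d.
Proof.
move=> kd; case: (leqP k b) => [kb|bk]; [rewrite bumpR // | rewrite bumpL //]; last first.
  by rewrite !strip_gt //; lia.
apply/stripP/stripP => -[db H]; split=> [|c cP]; try lia.
  by have := H c.+1; rewrite !lift_allR //; lia.
by case: c cP => // c cP; have := H c; rewrite !lift_allR //; lia.
Qed.

Lemma step_lift k e b : e b <= e k -> b != k ->
  step (lift_all k e) (bump k b) =1 lift_all k (step e b).
Proof.
move=> ebk nbk d; case: (leqP d k) => dk.
  by rewrite /step strip_liftL // !lift_allL.
by case: d dk => // d dk; rewrite /step strip_liftR // !lift_allR.
Qed.

Lemma legal_lift k e b : e b <= e k -> b != k ->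
  legal (lift_all k e) (bump k b) = legal e b.
Proof.
move=> ebk nbk; case: (leqP k b) => [kb|bk]; last first.
  rewrite bumpL //; apply/legalP/legalP => H a ab.
    by have := H a ab; rewrite -{1}(bumpL bk) strip_liftL ?lift_allL //; lia.
  by rewrite -{1}(bumpL bk) strip_liftL ?lift_allL //; [move/(H a ab); lia|lia..].
apply/legalP/legalP => H a ab s.
  case: (leqP k a) => ka.
    by have := H a.+1; rewrite strip_liftR ?bumpR ?lift_allR //; lia.
  by have /stripP[_ Hs] := s; have := Hs k; lia.
have [ak|ak] := leqP a k; last first.
  case: a ak ab s => // a ka ab; rewrite strip_liftR ?(ltnW ka) // bumpR // !lift_allR //.
  by move=> /H; rewrite bumpR // in ab; lia.
have [eak|nak] := eqVneq a k.
  by subst a; rewrite strip_liftR // in s; have /stripP[_ Hs] := s; have := Hs k; lia.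
rewrite strip_liftL // in s; last lia.
by have /stripP[_ Hs] := s; have := Hs k; lia.
Qed.

Lemma run_nil e : run e [::] = e.
Proof. by []. Qed.

Lemma run_cons e b w : run e (b :: w) = run (step e b) w.
Proof. by []. Qed.

Lemma run_gt e w b : b \in w -> e b < run e w b.
Proof.
elim: w e => // c w IH e; rewrite inE run_cons => /orP[/eqP->|bw].
  by apply: leq_trans (run_ge _ _ _); rewrite /step stripbb addn1.
by apply: leq_ltn_trans (IH _ bw); rewrite leq_addr.
Qed.

Lemma dup_id k : dup k id =1 id.
Proof. by move=> [|d]; rewrite /dup //=; case: ifP. Qed.

Lemma eq_record k e1 e2 : e1 =1 e2 -> record k e1 -> record k e2.
Proof. by move=> E r d dk; rewrite -!E; apply: r. Qed.

Lemma record_dup k e : record k (dup k e) -> record k e.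
Proof. by move=> r d dk; have := r d dk; rewrite !dupL // ltnW. Qed.

(** By [record_run], a record at the end was one at every earlier time, so [step_dup] applies at
    each step. *)
Lemma run_dup k e u : valid e u -> record k (run e u) ->
  valid (dup k e) (map (bump k) u) /\
  run (dup k e) (map (bump k) u) =1 dup k (run e u).
Proof.
elim: u e => //= b u IH e /andP[lb vu] r.
have re : record k e by apply: (@record_run k e (b :: u)); rewrite //= lb.
have [v1 r1] := IH _ vu r; split.
  by rewrite legal_dup // lb (eq_valid _ (step_dup b re)).
by move=> d; rewrite /= !run_cons (eq_run _ (step_dup b re)) r1.
Qed.

Lemma run_undup k e u : valid (dup k e) (map (bump k) u) ->
  record k (run (dup k e) (map (bump k) u)) -> valid e u /\ record k (run e u).
Proof.
elim: u e => [|b u IH] e; first by move=> _ /record_dup.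
move=> vu r; have re : record k e by apply/record_dup/(record_run vu r).
move: vu r; rewrite /= legal_dup // => /andP[-> vu].
rewrite /= !run_cons => r; apply: IH.
  by rewrite -(eq_valid _ (step_dup b re)).
by apply: eq_record r; apply/eq_run/step_dup.
Qed.

(** The bound on final heights yields [e b <= e k] at every step. It is accepted on either side
    because insertion knows it for the short word and deletion for the long one. *)
Lemma run_lift k e u : k \notin u ->
  (forall b, b \in u -> run e u b <= e k) \/
  (forall b, b \in u ->
     run (lift_all k e) (map (bump k) u) (bump k b) <= (e k).+1) ->
  [/\ valid (lift_all k e) (map (bump k) u) = valid e u,
      run (lift_all k e) (map (bump k) u) =1 lift_all k (run e u)
    & run e u k = e k].
Proof.
elim: u e => //= b u IH e; rewrite inE negb_or eq_sym => /andP[nbk nku] H.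
have ebk : e b <= e k.
  case: H => H.
    by apply: leq_trans (H b (mem_head _ _)); apply: run_ge e (b :: u) b.
  have := leq_trans (run_ge _ (map (bump k) (b :: u)) _) (H b (mem_head _ _)).
  case: (leqP k b) => kb; first by rewrite bumpR // lift_allR.
  by rewrite bumpL // lift_allL // ltnW.
have sk : step e b k = e k.
  rewrite /step; case: stripP => [[kb Hk]|]; last by rewrite addn0.
  by have := Hk k; lia.
have H' : (forall c, c \in u -> run (step e b) u c <= step e b k) \/
    (forall c, c \in u -> run (lift_all k (step e b)) (map (bump k) u) (bump k c)
       <= (step e b k).+1).
  rewrite sk; case: H => H; [left|right] => c cu; have := H c; rewrite inE cu orbT => /(_ isT) //.
  by rewrite /= !run_cons (eq_run _ (step_lift ebk nbk)).
have [] := IH _ nku H'; rewrite sk.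
rewrite -(eq_valid _ (step_lift ebk nbk)) legal_lift // => -> r1 r2; split=> //.
by move=> d; rewrite /= !run_cons (eq_run _ (step_lift ebk nbk)).
Qed.

(* Maximal chains of [T_(m+1)], as the sequence of the last rows of the successive
   strips, rows being numbered from 0. *)
Definition is_chain (m : nat) (w : seq nat) : bool :=
  [&& all (fun b => b < m) w, valid id w & all (fun d => run id w d == m) (iota 0 m)].

(** Step [r], counted from 0, reaches the first row, completes row [k], and finds row [k.+1] already
    complete. For [k = m.-1] the last condition concerns row [m], where [e m = m] from the start of
    a chain. The initial state is a parameter for the sake of inductions on the word. *)
Definition plus_from (m : nat) (e0 : nat -> nat) (w : seq nat) (r : nat) : bool :=
  let e := run e0 (take r w) in let k := nth 0 w r in
  [&& strip e k 0, (e k).+1 == m & e k.+1 == m].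

Definition plus_at (m : nat) : seq nat -> nat -> bool := plus_from m id.

(** The final condition extends to [d = m] because row [m] never moves. *)
Lemma is_chainP m w :
  reflect [/\ forall b, b \in w -> b < m, valid id w
            & forall d, d <= m -> run id w d = m] (is_chain m w).
Proof.
apply: (iffP and3P) => -[/allP wm vw H]; split=> //; try exact/allP.
  move=> d dm; have [->|nd] := eqVneq d m; last first.
    by apply/eqP/(allP H); rewrite mem_iota; lia.
  by rewrite (@run_out _ _ m) //; apply/allP.
by apply/allP => d; rewrite mem_iota => dm; apply/eqP/H; lia.
Qed.

(** * Inserting a plus-full-set into a chain, and removing one *)

Section Insert.

Variables (m k : nat) (u v : seq nat).
Hypotheses (km : k <= m) (uk : run id u k = m).
Hypothesis ud : forall d, d < k -> run id u d < m.

Definition insert_row := map (bump k) u ++ k :: map (bump k) v.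

Lemma record_u : record k (run id u).
Proof. by move=> d dk; rewrite uk ud. Qed.

(** Row [k] of the duplicated state is a record, so nothing blocks its strip before row [0]. *)
Lemma strip_insert d : strip (dup k (run id u)) k d = (d <= k).
Proof.
apply/stripP/idP => [[]//|dk]; split=> // c cP.
by rewrite !dupL ?record_u //; lia.
Qed.

Lemma step_insert : step (dup k (run id u)) k =1 lift_all k (run id u).
Proof.
move=> d; rewrite /step strip_insert /dup /lift_all.
by case: ifP => _; rewrite ?addn1 ?addn0.
Qed.

Lemma legal_insert : legal (dup k (run id u)) k.
Proof.
by apply/legalP => a ak _; rewrite !dupL ?(ltnW ak) //; have := record_u ak; lia.
Qed.

Lemma run_insert_u u1 : valid id u1 -> record k (run id u1) ->
  valid id (map (bump k) u1) /\ run id (map (bump k) u1) =1 dup k (run id u1).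
Proof.
move=> vu ru; have [v1 r1] := run_dup vu ru; split.
  by rewrite -(eq_valid _ (@dup_id k)).
by move=> d; rewrite -r1; apply: eq_run => x; rewrite dup_id.
Qed.


(** [v1] is arbitrary because [plus_insert] needs this for prefixes of [v], to know the state before
    each later step. *)
Lemma run_insert_v v1 : valid id u -> k \notin v1 ->
  (forall b, b \in v1 -> run id (u ++ v1) b <= m) ->
  [/\ valid id (map (bump k) u ++ k :: map (bump k) v1) = valid id (u ++ v1),
      run id (map (bump k) u ++ k :: map (bump k) v1) =1
        lift_all k (run id (u ++ v1))
    & run id (u ++ v1) k = m].
Proof.
move=> vu kv1 H; have [vu' ru'] := run_insert_u vu record_u.
rewrite !run_cat; have [] := @run_lift k (run id u) v1 kv1.
  by left => b bv; rewrite uk -run_cat H.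
move=> v2 r2 r3; have E := eq_step k ru'.
rewrite !valid_cat vu vu' /= (eq_legal _ ru') legal_insert /=.
split; [|move=> d|by rewrite r3].
  by rewrite (eq_valid _ E) (eq_valid _ step_insert) v2.
by rewrite run_cons (eq_run _ E) (eq_run _ step_insert) r2.
Qed.

Hypothesis chain : is_chain m (u ++ v).

(** Row [k] is already complete after [u]; a further step ending there would push it beyond [m]. *)
Lemma notin_v : k \notin v.
Proof.
apply/negP => /(run_gt (run id u)); rewrite uk -run_cat.
by case/is_chainP: chain => _ _ H; rewrite H // ltnn.
Qed.

Lemma insert_chain : is_chain m.+1 insert_row.
Proof.
have /is_chainP[wm vw H] := chain.
have vu : valid id u by move: vw; rewrite valid_cat => /andP[].
have [|v1 r1 r2] := run_insert_v vu notin_v.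
  by move=> b bv; rewrite H // ltnW // wm // mem_cat bv orbT.
apply/is_chainP; split; rewrite ?v1 // => d.
  have bm b : b \in u ++ v -> bump k b < m.+1.
    by move/wm; rewrite /bump; case: leqP; lia.
  rewrite mem_cat inE => /or3P[/mapP[b bu ->]|/eqP->//|/mapP[b bv ->]];
  by rewrite bm // mem_cat ?bu ?bv ?orbT.
move=> dm; rewrite r1; case: (leqP d k) => dk.
  by rewrite lift_allL // H //; apply: leq_trans dk km.
by case: d dm dk => // d dm dk; rewrite lift_allR // H.
Qed.

Lemma plus_insert_new : plus_at m.+1 insert_row (size u).
Proof.
have /is_chainP[wm vw H] := chain.
have vu : valid id u by move: vw; rewrite valid_cat => /andP[].
have [vu' ru'] := run_insert_u vu record_u.
rewrite /plus_at /plus_from /insert_row -(size_map (bump k) u) take_size_cat //.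
rewrite nth_cat ltnn subnn /= (eq_strip _ ru') strip_insert leq0n !ru'.
by rewrite dupL // dupR // uk eqxx.
Qed.

(** [bump (size u) j] is the new position of the old step [j]. After the insertion every value and
    the target [m] grow by one; before it, only the rows below [k] do, so steps ending above [k]
    need a separate argument. *)
Lemma plus_insert j : j < size (u ++ v) ->
  plus_at m.+1 insert_row (bump (size u) j) = plus_at m (u ++ v) j.
Proof.
move=> jw; have /is_chainP[wm vw H] := chain.
have vu : valid id u by move: vw; rewrite valid_cat => /andP[].
rewrite /plus_at /plus_from /insert_row; case: (ltnP j (size u)) => ju.
  rewrite bumpL // !take_cat !nth_cat size_map ju -map_take (nth_map 0) //.
  set b := nth 0 u j; set e := run id (take j u).
  have vj : valid id (take j u).
    by move: vu; rewrite -{1}(cat_take_drop j u) valid_cat => /andP[].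
  have rj : record k e.
    apply: (@record_run _ _ (drop j u)); last by rewrite -run_cat cat_take_drop; apply: record_u.
    by move: vu; rewrite -{1}(cat_take_drop j u) valid_cat => /andP[].
  have [_ re] := run_insert_u vj rj; rewrite -/e in re.
  rewrite (eq_strip _ re) !re strip_dupL //.
  case: (ltnP b k) => bk; last by rewrite bumpR // !dupR ?(leqW bk) // !eqSS.
  (* Such a step is a plus-full-set in neither chain: its row [b] is still incomplete at the end of
     [u], so step [j] does not complete it. *)
  rewrite bumpL // !dupL ?(ltnW bk) //; have := ud bk.
  have : b \in drop j u by rewrite (drop_nth 0) // mem_head.
  move=> /(run_gt e); rewrite -run_cat cat_take_drop.
  by move=> h1 h2; apply/and3P/and3P => -[_ /eqP h3 _]; lia.
have [j0 j1] : (j < size u) = false /\ (j.+1 < size u) = false by lia.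
rewrite bumpR // !take_cat !nth_cat size_map j0 j1.
rewrite subSn //= (nth_map 0); last by move: jw; rewrite size_cat; lia.
rewrite -map_take; set j' := j - size u; set b := nth 0 v j'.
have jv : j' < size v by move: jw; rewrite size_cat /j'; lia.
have bv : b \in v by apply: mem_nth.
have nbk : b != k by apply: contraNneq notin_v => <-.
have bm : b < m by rewrite wm // mem_cat bv orbT.
have le c : run id (u ++ take j' v) c <= run id (u ++ v) c.
  by rewrite -{2}(cat_take_drop j' v) catA (run_cat id (u ++ _)) run_ge.
have [||_ r1 r2] := @run_insert_v (take j' v) vu.
- by apply/negP => /mem_take; apply/negP: notin_v.
- move=> c cv; apply: leq_trans (le c) _; rewrite H // ltnW // wm // mem_cat.
  by rewrite (mem_take cv) orbT.
set e := run id (u ++ take j' v) in r1 r2 le *.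
have ebk : e b <= e k by rewrite r2; apply: leq_trans (le b) _; rewrite H // ltnW.
rewrite (eq_strip _ r1) !r1 strip_liftL //.
case: (ltnP b k) => bk; first by rewrite bumpL // !lift_allL ?(ltnW bk) // !eqSS.
by rewrite bumpR // !lift_allR ?(leqW bk) // !eqSS.
Qed.

End Insert.

(** No other step ends at row [k], so the remaining letters all lie in the image of [bump k]. Before
    the removed step rows [k] and [k.+1] move together; after it neither is the end of a step. *)
Lemma delete_chain m k U V : is_chain m.+1 (U ++ k :: V) ->
  plus_at m.+1 (U ++ k :: V) (size U) ->
  exists u v, [/\ U = map (bump k) u, V = map (bump k) v, is_chain m (u ++ v),
    run id u k = m & k <= m /\ forall d, d < k -> run id u d < m].
Proof.
move=> /is_chainP[wm vw H]; rewrite /plus_at /plus_from take_size_cat // nth_cat ltnn subnn /=.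
case/and3P=> /stripP[_ r0] /eqP[rk] /eqP rk1.
have km : k <= m by rewrite -ltnS wm // mem_cat inE eqxx orbT.
have nk : forall W, k \notin W -> W = map (bump k) (map (unbump k) W).
  move=> W kW; rewrite -map_comp -[LHS]map_id; apply/eq_in_map => b bW /=.
  by rewrite unbumpKcond (negbTE (_ : b != k)) //; apply: contraNneq kW => <-.
move: vw; rewrite valid_cat /= => /and3P[vU lk vV].
have rU1 : record k.+1 (run id U).
  move=> d; rewrite ltnS leq_eqVlt => /orP[/eqP->|dk]; first by rewrite rk rk1.
  by apply: ltn_trans (r0 d _) _; rewrite ?dk // rk rk1.
(* Throughout [U], row [k.+1] is a record, and [flat] then forces [e k.+1 = (e k).+1]. A step ending
   at [k] would raise [e k] but not [e k.+1], destroying the record. *)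
have kU : k \notin U.
  apply/negP => kU; have [U1 [U2 EU]] : exists U1 U2, U = rcons U1 k ++ U2.
    by case/splitPr: kU => U1 U2; exists U1, U2; rewrite cat_rcons.
  have r1 : record k.+1 (run id (rcons U1 k)).
    apply: (@record_run _ _ U2); last by rewrite -run_cat -EU.
    by move: vU; rewrite EU valid_cat => /andP[].
  have l1 : legal (run id U1) k.
    by move: vU; rewrite EU valid_cat -cats1 valid_cat /= andbT => /andP[/andP[_ ->]].
  rewrite -cats1 run_cat run_cons in r1.
  have r2 := record_step l1 r1.
  have := r2 k (ltnSn k); have := r1 k (ltnSn k).
  have := @flat_run id U1 (fun d => leqnn _) k.
  by rewrite run_nil /step stripbb strip_gt //=; lia.
have kV : k \notin V.
  apply/negP => /(run_gt (step (run id U) k)); rewrite -run_cons -run_cat H; last lia.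
  by rewrite /step stripbb rk; lia.
have EU := nk _ kU; have EV := nk _ kV.
set u := map (unbump k) U in EU; set v := map (unbump k) V in EV.
exists u, v.
have [vu ru] : valid id u /\ record k (run id u).
  apply: (@run_undup k); rewrite -?EU.
    by rewrite (eq_valid _ (@dup_id k)).
  apply: eq_record (_ : record k (run id U)); first by apply: eq_run => d; rewrite dup_id.
  by move=> d dk; apply: r0; rewrite dk.
have [_ rU] := run_insert_u vu ru; rewrite -EU in rU.
have uk : run id u k = m by rewrite -rk rU dupL.
have ud d : d < k -> run id u d < m by move=> /ru; rewrite uk.
have kv : k \notin v.
  apply/negP => /(map_f (bump k)); rewrite -EV bumpR // => /(run_gt (step (run id U) k)).
  rewrite -run_cons -run_cat H; last lia.
  by rewrite /step rk1; lia.
have E : step (run id U) k =1 lift_all k (run id u).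
  move=> d; by rewrite (eq_step k rU) (step_insert km uk ud).
have kv' : forall b, b \in v -> run (lift_all k (run id u)) (map (bump k) v) (bump k b)
    <= (run id u k).+1.
  move=> b bv; rewrite -EV -(eq_run _ E) -run_cons -run_cat uk.
  have bV : bump k b \in V by rewrite EV map_f.
  have bm : bump k b < m.+1 by apply: wm; rewrite mem_cat inE bV !orbT.
  by rewrite H // ltnW.
have [v1 r1 r2] := run_lift kv (or_intror kv').
have rW d : run id (U ++ k :: V) d = lift_all k (run id (u ++ v)) d.
  rewrite run_cat run_cons (eq_run _ E) EV r1 /lift_all; by case: ifP; rewrite run_cat.
split=> //; apply/is_chainP; split=> [b|| d dm].
- have bB : bump k b < m.+1 -> k <= m -> b < m.
    by rewrite /bump; case: (leqP k b); lia.
  rewrite mem_cat => /orP[] bu; apply: bB => //.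
  + by apply: wm; rewrite mem_cat EU map_f.
  + by apply: wm; rewrite mem_cat inE EV map_f ?orbT.
- by rewrite valid_cat vu -v1 -EV -(eq_valid _ E).
- case: (leqP d k) => dk.
    by have := H d ltac:(lia); rewrite rW lift_allL // => -[].
  by have := H d.+1 ltac:(lia); rewrite rW lift_allR ?(ltnW dk) // => -[].
Qed.

(** * Words without plus-full-sets *)

Definition pairs_done (m : nat) (e : nat -> nat) : nat :=
  \sum_(d < m) ((e d == m) && (e d.+1 == m)).

Lemma sum_eq_le1 m b : \sum_(d < m) (val d == b) <= 1.
Proof.
suff -> : \sum_(d < m) (val d == b) = (b < m) by exact: leq_b1.
by elim: m => [|m IH]; rewrite ?big_ord0 // big_ord_recr /= IH ltnS; case: ltngtP.
Qed.

(** Only row [b] can become complete, since the other rows of the strip have [e d < e b]. If the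
    strip reaches row [0], the second term gains [2] and no pair is created: [b.-1] is incomplete,
    and so is [b.+1] because the step is no plus-full-set. Otherwise at most the two pairs
    containing [b] are new. *)
Lemma pairs_done_step m e b : b < m -> step e b b <= m ->
  ~~ [&& strip e b 0, (e b).+1 == m & e b.+1 == m] ->
  pairs_done m (step e b) + (step e b 0).*2 <= pairs_done m e + (e 0).*2 + 2.
Proof.
move=> bm; rewrite {1}/step stripbb addn1 => ebm npl.
have lt d : d < b -> strip e b d -> e d < e b by move=> db /stripP[_]; apply; lia.
have [s0|s0] := boolP (strip e b 0); rewrite [step e b 0]/step ?s0 ?(negbTE s0) /=.
  suff: pairs_done m (step e b) <= pairs_done m e by clear; lia.
  apply: leq_sum => d _; case: (boolP (_ && _)) => //= /andP[/eqP d1 /eqP d2].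
  have /stripP[_ H0] := s0; rewrite s0 /= in npl.
  have nsd : strip e b d = false.
    apply/negP => sd; have /stripP[db _] := sd; move: d1; rewrite /step sd /= => d1.
    have [E|nb] := eqVneq (d : nat) b.
      by move: d2; rewrite /step E strip_gt // addn0; move: npl; rewrite -E; lia.
    by have := lt d; lia.
  move: d1; rewrite /step nsd addn0 => ed.
  have bd : b < d.
    rewrite ltnNge; apply/negP => db; have [E|nb] := eqVneq (d : nat) b; first by rewrite E in ed; lia.
    by have := H0 d; lia.
  by move: d2; rewrite /step strip_gt ?(leqW bd) // addn0; lia.
suff: pairs_done m (step e b) <= pairs_done m e + 2 by clear; lia.
apply: (@leq_trans (\sum_(d < m) (((e d == m) && (e d.+1 == m)) +
   ((val d == b) + (val d == b.-1))))); last first.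
  by rewrite big_split /= leq_add2l big_split /= -[2]/(1 + 1) leq_add // sum_eq_le1.
apply: leq_sum => d _; case: (boolP (_ && _)) => //= /andP[/eqP d1 /eqP d2].
have [E|nb] := eqVneq (d : nat) b; first by lia.
have [E|nb1] := eqVneq (d : nat) b.-1; first by lia.
have nsd : strip e b d = false.
  apply/negP => sd; have := lt _ _ sd; have /stripP[db _] := sd.
  by move: d1; rewrite /step sd /=; lia.
have nsd1 : strip e b d.+1 = false.
  apply/negP => sd; have := lt _ _ sd; have /stripP[db _] := sd.
  by move: d2; rewrite /step sd /=; lia.
by move: d1 d2; rewrite /step nsd nsd1 !addn0 => -> ->; rewrite eqxx.
Qed.

Lemma pairs_done_run m e w : all (fun b => b < m) w ->
  (forall d, d < m -> run e w d <= m) ->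
  (forall r, r < size w -> ~~ plus_from m e w r) ->
  pairs_done m (run e w) + (run e w 0).*2 <= pairs_done m e + (e 0).*2 + (size w).*2.
Proof.
elim: w e => [|b w IH] e; first by rewrite run_nil addn0.
rewrite /= run_cons => /andP[bm wm] H np.
have IHw := IH (step e b) wm H (fun r => np r.+1).
have := @pairs_done_step m e b bm _ (np 0 isT).
have := H b bm; have := run_ge (step e b) w b; lia.
Qed.

(** The potential grows from [0] to [m + 2 * m], by at most [2] per step. *)
Lemma no_plus_bound m w : is_chain m w ->
  (forall r, r < size w -> ~~ plus_at m w r) -> 3 * m <= 2 * size w.
Proof.
move=> /is_chainP[wm vw H] np.
have := @pairs_done_run m id w _ _ np.
have -> : pairs_done m id = 0.
  by rewrite /pairs_done big1 // => d _; rewrite ltn_eqF.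
have -> : pairs_done m (run id w) = m.
  rewrite /pairs_done (eq_bigr (fun=> 1)) ?sum1_card ?card_ord // => d _.
  by rewrite !H ?eqxx // ltnW.
rewrite H // => /(_ _ _)h; have {h} : m + m.*2 <= 0 + 0.*2 + (size w).*2.
  by apply: h; [apply/allP | move=> d dm; rewrite H // ltnW].
lia.
Qed.

(** This attains equality in [no_plus_bound]. Rows are completed in pairs from the bottom: two steps
    at row [j'.*2] complete it while row [j'.*2.+1] still lacks one box, and the third step adds
    that box alone, being blocked by row [j'.*2]. So no step that reaches row [0] completes a row
    just above a completed one. *)
Fixpoint zigzag (j : nat) : seq nat :=
  if j is j'.+1 then [:: j'.*2, j'.*2, j'.*2.+1 & zigzag j'] else [::].

Lemma size_zigzag j : size (zigzag j) = 3 * j.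
Proof. by elim: j => //= j ->; lia. Qed.

Lemma zigzag_lt j b : b \in zigzag j -> b < j.*2.
Proof.
elim: j => //= j IH; rewrite !inE => /or4P[/eqP->|/eqP->|/eqP->|/IH]; lia.
Qed.

(** The state when [j] pairs remain: the rows from [j.*2] on are complete, the others have
    [(q - j).*2] boxes each. *)
Definition zigzag_state (q j d : nat) : nat :=
  if d < j.*2 then d + (q - j).*2 else maxn d q.*2.

Lemma run_zigzag q j e : j <= q -> e =1 zigzag_state q j ->
  [/\ valid e (zigzag j), run e (zigzag j) =1 zigzag_state q 0
    & forall r, r < size (zigzag j) -> ~~ plus_from q.*2 e (zigzag j) r].
Proof.
elim: j e => [|j IH] e jq E; first by split.
have s0 d : strip e j.*2 d = (d <= j.*2).
  apply/stripP/idP => [[]//|dj]; split=> // c cP.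
  by rewrite !E /zigzag_state; do ![case: ifP => ?]; lia.
set e1 := step e j.*2.
have E1 d : e1 d = if d <= j.*2 then d + (q - j).*2.-1 else zigzag_state q j.+1 d.
  rewrite /e1 /step s0 E /zigzag_state; do ![case: ifP => ?]; lia.
have s1 d : strip e1 j.*2 d = (d <= j.*2).
  apply/stripP/idP => [[]//|dj]; split=> // c cP.
  by rewrite !E1 /zigzag_state; do ![case: ifP => ?]; lia.
set e2 := step e1 j.*2.
have E2 d : e2 d = if d <= j.*2 then d + (q - j).*2 else zigzag_state q j.+1 d.
  rewrite /e2 /step s1 E1 /zigzag_state; do ![case: ifP => ?]; lia.
have s2 d : strip e2 j.*2.+1 d = (d == j.*2.+1).
  apply/stripP/eqP => [[dj H]|->]; last by split=> // c; lia.
  have [//|nd] := eqVneq d j.*2.+1; have := H j.*2.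
  by rewrite !E2 /zigzag_state doubleS !leqnn ltnn /=; lia.
have E3 : step e2 j.*2.+1 =1 zigzag_state q j.
  move=> d; rewrite /step s2 E2 /zigzag_state.
  by case: eqP => ?; do ![case: ifP => ?]; lia.
have [v r np] := IH _ (ltnW jq) E3; split.
- rewrite /= -/e1 -/e2 v andbT; apply/and3P; split; apply/legalP => a aj.
  + by rewrite !E /zigzag_state; do ![case: ifP => ?]; lia.
  + by rewrite !E1 /zigzag_state; do ![case: ifP => ?]; lia.
  + rewrite s2 => /eqP[->]; by rewrite !E2 /zigzag_state doubleS !leqnn ltnn; lia.
- by rewrite /= !run_cons -/e1 -/e2.
- case=> [|[|[|i]]]; rewrite /plus_from /= ?run_cons ?run_nil -/e1 -/e2.
  + move=> _; rewrite !E /zigzag_state.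
    by apply/negP => /and3P[_]; do ![case: ifP => ?]; lia.
  + move=> _; rewrite !E1 /zigzag_state doubleS !leqnn ltnn.
    by apply/negP => /and3P[_]; lia.
  + by move=> _; rewrite s2.
  + exact: np.
Qed.

Lemma zigzag_chain q : is_chain q.*2 (zigzag q).
Proof.
have E : id =1 zigzag_state q q by move=> d; rewrite /zigzag_state; case: ifP; lia.
have [v r _] := run_zigzag (leqnn q) E.
apply/is_chainP; split=> // [b|d dq]; first exact: zigzag_lt.
by rewrite r /zigzag_state /=; lia.
Qed.

Lemma zigzag_no_plus q r : r < size (zigzag q) -> ~~ plus_at q.*2 (zigzag q) r.
Proof.
have E : id =1 zigzag_state q q by move=> d; rewrite /zigzag_state; case: ifP; lia.
by have [_ _] := run_zigzag (leqnn q) E; apply.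
Qed.

(** * Counting words *)

(** The bijection [g] lives on plain sequences; [f] and [f'] embed the finite types used for
    counting, so the combinatorics stays free of bounded types. *)
Lemma card_transfer (A B : finType) (X Y : eqType) (f : A -> X) (f' : B -> Y)
    (P : pred X) (Q : pred Y) (g : X -> Y) :
  injective f -> injective f' ->
  (forall x, P x -> exists a, f a = x) -> (forall y, Q y -> exists b, f' b = y) ->
  (forall x, P x -> Q (g x)) -> {in P &, injective g} ->
  (forall y, Q y -> exists2 x, P x & g x = y) ->
  #|[set a | P (f a)]| = #|[set b | Q (f' b)]|.
Proof.
move=> fi fi' fP fQ gPQ gi gQ.
rewrite !cardE -(size_map f) -(size_map g) -(size_map f').
apply/perm_size/uniq_perm.
- rewrite map_inj_in_uniq; first by rewrite map_inj_uniq ?enum_uniq.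
  by move=> x y /mapP[a + ->] /mapP[b + ->]; rewrite !mem_enum !inE; apply: gi.
- by rewrite map_inj_uniq ?enum_uniq.
move=> y; apply/mapP/mapP => [[x /mapP[a + ->] ->]|[b + ->]];
  rewrite mem_enum inE.
  by move=> Pa; have [b Eb] := fQ _ (gPQ _ Pa); exists b; rewrite // mem_enum inE Eb gPQ.
move=> Qb; have [x Px Ex] := gQ _ Qb; exists x => //; have [a Ea] := fP _ Px.
by apply/mapP; exists a; rewrite // mem_enum inE Ea.
Qed.

Definition word_val l m (w : l.-tuple 'I_m) : seq nat := map val w.

Lemma word_val_inj l m : injective (@word_val l m).
Proof. by move=> x y /(inj_map val_inj)/val_inj. Qed.

Lemma size_word_val l m (w : l.-tuple 'I_m) : size (word_val w) = l.
Proof. by rewrite size_map size_tuple. Qed.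

Lemma word_val_onto m l w : size w = l -> is_chain m w ->
  exists t : l.-tuple 'I_m, word_val t = w.
Proof.
move=> <- /and3P[/allP wm _ _].
pose s : seq 'I_m := pmap insub w.
have E : map val s = w.
  rewrite (pmap_filter (insubK _)); apply/all_filterP/allP => b /wm bm.
  by rewrite /= isSome_insub.
have Es : size s == size w by rewrite -E size_map.
by exists (Tuple Es).
Qed.

Definition num_plus (m : nat) (w : seq nat) : nat :=
  count (plus_at m w) (iota 0 (size w)).

Definition chains_plus (m l p : nat) : nat :=
  #|[set w : l.-tuple 'I_m | is_chain m (word_val w) && (num_plus m (word_val w) == p)]|.

(** If no row before [m] is complete, [find] returns [m], which is correct: row [m] counts as
    complete from the start. *)
Definition insert_at (m : nat) (x : seq nat * nat) : seq nat :=
  let: (w, r) := x in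
  let k := find (fun d => run id (take r w) d == m) (iota 0 m) in
  insert_row k (take r w) (drop r w).

Lemma size_insert_row k u v : size (insert_row k u v) = (size (u ++ v)).+1.
Proof. by rewrite !size_cat /= !size_map addnS. Qed.

Lemma insert_row_inj k k' u u' v v' : size u = size u' ->
  insert_row k u v = insert_row k' u' v' -> u ++ v = u' ++ v'.
Proof.
move=> uu' /eqP; rewrite eqseq_cat ?size_map // eqseq_cons.
case/and3P=> /eqP Eu /eqP Ek /eqP Ev; rewrite -Ek in Eu Ev.
have bi : injective (bump k) by exact: can_inj (bumpK k).
by rewrite (inj_map bi Eu) (inj_map bi Ev).
Qed.

Lemma first_full m u (k := find (fun d => run id u d == m) (iota 0 m)) v :
  is_chain m (u ++ v) ->
  [/\ k <= m, run id u k = m & forall d, d < k -> run id u d < m].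
Proof.
move=> /is_chainP[wm vw H].
have km : k <= m by rewrite -[X in _ <= X](size_iota 0 m) find_size.
split=> // [|d dk].
  have [Ek|nk] := eqVneq k m.
    rewrite Ek (@run_out _ _ m) //; apply/allP => b bu.
    by rewrite wm // mem_cat bu.
  have kl : k < m by rewrite ltn_neqAle nk.
  have := @nth_find _ 0 (fun d => run id u d == m) (iota 0 m).
  by rewrite has_find size_iota => /(_ kl); rewrite nth_iota //= => /eqP.
have := before_find 0 dk; rewrite nth_iota; last exact: leq_trans dk km.
move/negbT; rewrite add0n ltn_neqAle => -> /=.
by rewrite -(H d) ?run_cat ?run_ge //; apply: ltnW (leq_trans dk km).
Qed.

Lemma first_full_uniq m u k : k <= m -> run id u k = m ->
  (forall d, d < k -> run id u d < m) ->
  find (fun d => run id u d == m) (iota 0 m) = k.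
Proof.
move=> km uk ud.
have -> : iota 0 m = iota 0 k ++ iota k (m - k) by rewrite -iotaD subnKC.
rewrite find_cat (_ : has _ (iota 0 k) = false); last first.
  by apply/hasPn => d; rewrite mem_iota => /ud; rewrite ltn_neqAle => /andP[].
rewrite size_iota; case Emk: (m - k) => [|j] /=; first by rewrite addn0.
by rewrite uk eqxx addn0.
Qed.

Lemma num_plus_insert m u v k : k <= m -> run id u k = m ->
  (forall d, d < k -> run id u d < m) -> is_chain m (u ++ v) ->
  num_plus m.+1 (insert_row k u v) = (num_plus m (u ++ v)).+1.
Proof.
move=> km uk ud ch; rewrite /num_plus size_insert_row; set l := size (u ++ v).
have ul : size u <= l by rewrite /l size_cat leq_addr.
(* The positions in the long word are the inserted one and the shifts of the old ones. *)
have /permP-> : perm_eq (iota 0 l.+1) (size u :: map (bump (size u)) (iota 0 l)).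
  apply: uniq_perm; rewrite ?iota_uniq ?cons_uniq //.
    rewrite map_inj_uniq ?iota_uniq ?andbT; last exact: can_inj (bumpK _).
    by apply/mapP => -[j _ /eqP]; rewrite (negbTE (neq_bump _ _)).
  move=> j; rewrite mem_iota in_cons; have [->|nj] := eqVneq j (size u); first by lia.
  apply/idP/mapP => [jl|[i]].
    by exists (unbump (size u) j); rewrite ?unbumpKcond ?mem_iota /unbump ?(negbTE nj) //=; lia.
  by rewrite mem_iota /bump => + ->; lia.
rewrite /= (plus_insert_new km uk ud ch) add1n count_map; congr _.+1.
by apply: eq_in_count => j; rewrite mem_iota /= => jl; exact: (plus_insert km uk ud ch).
Qed.

(** Double counting. The left side counts long chains with one of their plus-full-sets marked, the
    right side short chains with one of the [l.+1] moments chosen. Insertion at that moment and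
    deletion of the marked set are inverse to each other, the row being forced by
    [first_full_uniq]. *)
Lemma chains_plusS m l p :
  p.+1 * chains_plus m.+1 l.+1 p.+1 = l.+1 * chains_plus m l p.
Proof.
pose P (x : seq nat * nat) :=
  [&& size x.1 == l, is_chain m x.1, num_plus m x.1 == p & x.2 < l.+1].
pose Q (x : seq nat * nat) :=
  [&& size x.1 == l.+1, is_chain m.+1 x.1, num_plus m.+1 x.1 == p.+1,
      x.2 < l.+1 & plus_at m.+1 x.1 x.2].
pose f (x : l.-tuple 'I_m * 'I_l.+1) := (word_val x.1, val x.2).
pose f' (x : l.+1.-tuple 'I_m.+1 * 'I_l.+1) := (word_val x.1, val x.2).
have E1 : #|[set a | P (f a)]| = l.+1 * chains_plus m l p.
  rewrite mulnC -[X in _ * X](card_ord l.+1) -cardsT -cardsX; apply: eq_card => -[w r].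
  by rewrite !inE /P /f /= size_word_val eqxx /= ltn_ord !andbT.
have E2 : #|[set a | Q (f' a)]| = p.+1 * chains_plus m.+1 l.+1 p.+1.
  rewrite -sum1_card (eq_bigl (fun x : l.+1.-tuple 'I_m.+1 * 'I_l.+1 => [&& is_chain m.+1 (word_val x.1),
    num_plus m.+1 (word_val x.1) == p.+1 & plus_at m.+1 (word_val x.1) x.2])); last first.
    by move=> [w r]; rewrite !inE /Q /f' /= size_word_val eqxx ltn_ord.
  pose A := [set w : l.+1.-tuple 'I_m.+1 |
    is_chain m.+1 (word_val w) && (num_plus m.+1 (word_val w) == p.+1)].
  transitivity (\sum_(w in A) \sum_(r < l.+1 | plus_at m.+1 (word_val w) r) 1).
    by rewrite pair_big_dep; apply: eq_bigl => -[w r]; rewrite inE /= andbA.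
  rewrite (eq_bigr (fun=> p.+1)) ?sum_nat_const 1?mulnC // => w; rewrite inE => /andP[_ /eqP<-].
  by rewrite /num_plus size_word_val -sum1_count -(big_mkord (plus_at m.+1 (word_val w)) (fun=> 1)) /index_iota subn0.
rewrite -E1 -E2; symmetry.
apply: (@card_transfer _ _ _ _ f f' P Q (fun x => (insert_at m x, x.2))).
- by move=> [w r] [w' r'] [] /word_val_inj-> /val_inj->.
- by move=> [w r] [w' r'] [] /word_val_inj-> /val_inj->.
- move=> [w r] /and4P[/= /eqP sw cw _ rl].
  by have [t Et] := word_val_onto sw cw; exists (t, Ordinal rl); rewrite /f /= Et.
- move=> [w r] /and5P[/= /eqP sw cw _ rl _].
  by have [t Et] := word_val_onto sw cw; exists (t, Ordinal rl); rewrite /f' /= Et.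
- move=> [w r] /and4P[/= /eqP sw cw /eqP nw rl].
  have sr : size (take r w) = r by rewrite size_takel // sw.
  have cw' := cw; rewrite -(cat_take_drop r w) in cw'.
  have [km uk ud] := first_full cw'; rewrite /Q /=.
  rewrite size_insert_row cat_take_drop sw eqxx (insert_chain km uk ud cw').
  rewrite (num_plus_insert km uk ud cw') cat_take_drop nw eqxx rl /=.
  by have := plus_insert_new km uk ud cw'; rewrite sr.
- move=> [w r] [w' r'] /and4P[/= /eqP sw _ _ rl] /and4P[/= /eqP sw' _ _ _].
  move=> [+ Er]; rewrite -Er => /insert_row_inj; rewrite !cat_take_drop => -> //.
  by rewrite !size_takel ?sw ?sw'.
- move=> [W r] /and5P[/= /eqP sW cW /eqP nW rl pW].
  have EW : W = take r W ++ nth 0 W r :: drop r.+1 W.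
    by rewrite -drop_nth ?cat_take_drop ?sW.
  have sr : size (take r W) = r by rewrite size_takel // sW ltnW.
  have cW' := cW; have pW' := pW; rewrite EW in cW' pW'.
  rewrite -[X in plus_at _ _ X]sr in pW'.
  have [u [v [Eu Ev cw uk [km ud]]]] := delete_chain cW' pW'.
  have su : size u = r by rewrite -sr Eu size_map.
  have Ei : insert_row (nth 0 W r) u v = W by rewrite /insert_row -Eu -Ev -EW.
  exists (u ++ v, r).
    have := size_insert_row (nth 0 W r) u v; rewrite Ei sW => -[Esz].
    rewrite /P /= -Esz eqxx cw /= rl andbT.
    by have := num_plus_insert km uk ud cw; rewrite Ei nW => -[->].
  by rewrite /= take_size_cat // drop_size_cat // (first_full_uniq km uk ud) Ei.
Qed.

Lemma num_plus_le m w : num_plus m w <= size w.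
Proof. by rewrite /num_plus -{2}(size_iota 0 (size w)) count_size. Qed.

(** [chains_plusS] lowers [m], [l] and [p] together until [m = 0] or [l = 0], where a chain has no
    step that could be a plus-full-set. *)
Lemma chains_plus_gt m l p : m < p -> chains_plus m l p = 0.
Proof.
elim: p m l => // p IH [|m] [|l] mp; apply/eqP.
1,2,3: rewrite cards_eq0; apply/eqP/setP => w; rewrite !inE; apply/negP => /andP[/and3P[cw _ _] /eqP nw].
- by have := num_plus_le 0 (word_val w); rewrite nw size_word_val.
- by case: w cw nw => -[|[]].
- by have := num_plus_le m.+1 (word_val w); rewrite nw size_word_val.
by rewrite -(eqn_pmul2l (ltn0Sn p)) chains_plusS IH // !muln0.
Qed.

(** Iterating [chains_plusS] produces the factors [l], [l - 1], ... over [p], [p - 1], ..., that is,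
    a binomial coefficient. *)
Lemma chains_plusE m l p : p <= m ->
  chains_plus m l p = 'C(l, p) * chains_plus (m - p) (l - p) 0.
Proof.
elim: p m l => [|p IH] m l; first by rewrite bin0 mul1n !subn0.
case: m => // m pm; case: l => [|l].
  rewrite bin0n mul0n; apply/eqP; rewrite cards_eq0; apply/eqP/setP => w.
  rewrite !inE; apply/negP => /andP[_ /eqP nw].
  by have := num_plus_le m.+1 (word_val w); rewrite nw size_word_val.
apply/eqP; rewrite -(eqn_pmul2l (ltn0Sn p)) chains_plusS IH // !mulnA.
by rewrite mul_bin_diag !subSS.
Qed.

(* [s = i + 1], so that chains of [T_(m+1)] of length [m + s] are the elements
   of [C_i(m + 1)]. *)
Definition num_chains (s m : nat) : nat :=
  #|[set w : (m + s).-tuple 'I_m | is_chain m (word_val w)]|.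

Definition num_plus_free (s m : nat) : nat := chains_plus m (m + s) 0.

Lemma num_chains_sum s m :
  num_chains s m = \sum_(j < m.+1) 'C(m + s, j + s) * num_plus_free s j.
Proof.
have -> : num_chains s m = \sum_(p < (m + s).+1) chains_plus m (m + s) p.
  rewrite /num_chains -sum1_card.
  rewrite (partition_big (fun w => inord (num_plus m (word_val w)) : 'I_(m + s).+1) predT) //=.
  apply: eq_bigr => p _; rewrite /chains_plus -sum1_card; apply: eq_bigl => w.
  rewrite !inE; congr (_ && _); apply/eqP/eqP => [<-|->]; last by rewrite inord_val.
  by rewrite inordK // ltnS -{2}(size_word_val w) num_plus_le.
rewrite -(big_mkord xpredT (chains_plus m (m + s))) (big_cat_nat (n := m.+1)) //=; last by rewrite ltnS leq_addr.
rewrite [X in _ + X]big_nat_cond [X in _ + X]big1 ?addn0; last first.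
  by move=> p /andP[/andP[mp _] _]; apply: chains_plus_gt.
(* The chains are sorted by their number [p] of plus-full-sets; [j = m - p] is the size left after
   removing them all. *)
rewrite big_mkord (reindex_inj rev_ord_inj) /=; apply: eq_bigr => j _.
have jm : j <= m by rewrite -ltnS.
rewrite subSS chains_plusE ?leq_subr // (subKn jm).
rewrite -bin_sub; last by rewrite (leq_trans (leq_subr _ _)) ?leq_addr.
by rewrite /num_plus_free (_ : m + s - (m - j) = j + s) //; lia.
Qed.

Lemma num_plus_free_gt s m : s.*2 < m -> num_plus_free s m = 0.
Proof.
move=> sm; apply/eqP; rewrite cards_eq0; apply/eqP/setP => w; rewrite !inE.
apply/negP => /andP[cw /eqP/eqP nw].
have := @no_plus_bound m (word_val w) cw; rewrite size_word_val => /(_ _)h.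
have {h} : 3 * m <= 2 * (m + s); last by lia.
apply: h => r rl; move: nw; rewrite /num_plus size_word_val -leqn0 leqNgt -has_count.
by move/hasPn; apply; rewrite mem_iota.
Qed.

(** This keeps the top coefficient in [num_chains_poly] nonzero, so that the degree is exact. *)
Lemma num_plus_free_pos s : 0 < num_plus_free s s.*2.
Proof.
have [|t Et] := @word_val_onto s.*2 (s.*2 + s) (zigzag s) _ (zigzag_chain s).
  by rewrite size_zigzag; lia.
apply/card_gt0P; exists t; rewrite inE Et zigzag_chain /= /num_plus.
rewrite -leqn0 leqNgt -has_count; apply/hasPn => r; rewrite mem_iota => rl.
exact: zigzag_no_plus.
Qed.

(** The range no longer depends on [m], as polynomiality requires: for [j > m] the binomial
    vanishes, for [j > s.*2] the plus-free count does. *)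
Lemma num_chains_sum_truncated s m :
  num_chains s m = \sum_(j < s.*2.+1) 'C(m + s, j + s) * num_plus_free s j.
Proof.
pose F j := 'C(m + s, j + s) * num_plus_free s j.
rewrite num_chains_sum -!(big_mkord xpredT F).
have trunc a b : a <= b -> (forall j, a <= j -> F j = 0) ->
    \sum_(0 <= j < b) F j = \sum_(0 <= j < a) F j.
  move=> ab F0; rewrite (big_cat_nat (n := a)) //= [X in _ + X]big_nat_cond.
  by rewrite [X in _ + X]big1 ?addn0 // => j /andP[/andP[aj _] _]; exact: F0.
case: (leqP m s.*2) => ms.
  by symmetry; apply: trunc => // j jm; rewrite /F bin_small // ltn_add2r.
apply: trunc => [|j js]; first by rewrite ltnS ltnW.
by rewrite /F num_plus_free_gt ?muln0.
Qed.

Lemma mul_bin_bin n m k : m <= n -> k <= m ->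
  'C(n, m) * 'C(m, k) = 'C(n, k) * 'C(n - k, m - k).
Proof.
move=> mn km.
have F : 0 < k`! * (m - k)`! * (n - m)`! by rewrite !muln_gt0 !fact_gt0.
apply/eqP; rewrite -(eqn_pmul2r F); apply/eqP.
have nkm : n - k - (m - k) = n - m by lia.
transitivity n`!.
  rewrite -(bin_fact mn) -(bin_fact km); lia.
have := bin_fact (leq_trans km mn) => <-.
by rewrite -(@bin_fact (n - k) (m - k)) ?nkm; [lia|lia].
Qed.

(** * Chains of diagrams as words *)

Lemma young_nth Y d : young Y -> nth 0 Y d.+1 <= nth 0 Y d.
Proof.
move=> /andP[/(sortedP 0) sY _]; case: (ltnP d.+1 (size Y)) => dY; first exact: sY.
by rewrite nth_default.
Qed.

Lemma young_nthP Y : 0 \notin Y -> (forall d, nth 0 Y d.+1 <= nth 0 Y d) -> young Y.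
Proof. by move=> Y0 H; rewrite /young Y0 andbT; apply/(sortedP 0) => i _; apply: H. Qed.

Lemma young_pos Y d : young Y -> (0 < nth 0 Y d) = (d < size Y).
Proof.
move=> /andP[_ Y0]; case: (ltnP d (size Y)) => dY; last by rewrite nth_default.
by rewrite lt0n; apply: contraNneq Y0 => <-; apply: mem_nth.
Qed.

Lemma young_ext Y Z : young Y -> young Z -> nth 0 Y =1 nth 0 Z -> Y = Z.
Proof.
move=> yY yZ E; apply: (@eq_from_nth _ 0) => [|d _]; last exact: E.
have H d : (d < size Y) = (d < size Z) by rewrite -!young_pos // E.
by have := H (size Y); have := H (size Z); lia.
Qed.

Lemma nonincreasing_nth s : (forall d, nth 0 s d.+1 <= nth 0 s d) ->
  forall c d, c <= d -> nth 0 s d <= nth 0 s c.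
Proof.
move=> H c d /subnK <-; elim: (d - c) => // j IH.
by apply: leq_trans IH; rewrite addSn.
Qed.

(** In a weakly decreasing sequence the zeros form a tail, and the default value [0] of [nth]
    replaces them. *)
Lemma nth_filter_pos s d : (forall d, nth 0 s d.+1 <= nth 0 s d) ->
  nth 0 [seq x <- s | x != 0] d = nth 0 s d.
Proof.
elim: s d => // x s IH d H /=; have [E|nx] := eqVneq x 0.
  have z c : nth 0 (x :: s) c = 0.
    by have := nonincreasing_nth H (leq0n c); rewrite {2}E /=; lia.
  rewrite (z d) (_ : [seq y <- s | y != 0] = [::]) ?nth_nil //.
  apply/eqP; rewrite -[_ == _]negbK -has_filter; apply/negP => /hasP[y /(nthP 0)[j _ <-]].
  by have := z j.+1 => /= ->.
by case: d => // d; apply: IH => c; exact: (H c.+1).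
Qed.

Lemma young_filter_pos s : (forall d, nth 0 s d.+1 <= nth 0 s d) ->
  young [seq x <- s | x != 0].
Proof.
move=> H; apply: young_nthP => [|d]; first by rewrite mem_filter.
by rewrite !nth_filter_pos.
Qed.

Definition state (Y : seq nat) (d : nat) : nat := nth 0 Y d + d.

(** A legal step can be undone: a blocking row has [e c > e b], so it still blocks after [e b] has
    grown by one, and the strip can be read off the new state. *)
Lemma strip_step e b d : legal e b -> strip (step e b) b d = strip e b d.
Proof.
move=> lb; apply/idP/idP.
  move=> /stripP[db H]; case: (legal_blocked lb db) => // -[c cP ec].
  by have := H c cP; rewrite /step stripbb; lia.
move=> s; have /stripP[db H] := s; apply/stripP; split=> // c cP.
have sc : strip e b c by apply/stripP; split; [lia|move=> c' cP'; apply: H; lia].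
by rewrite /step stripbb sc !addn1 ltnS H.
Qed.

Lemma step_inj e1 e2 b : legal e1 b -> legal e2 b -> step e1 b =1 step e2 b -> e1 =1 e2.
Proof.
move=> l1 l2 E d; have := E d; rewrite {1 2}/step -strip_step // -[strip e2 b d]strip_step //.
by rewrite (eq_strip b E) => /addIn.
Qed.

(** The end row is the lowest row that the step moves. *)
Lemma step_letter_inj e b c : step e b =1 step e c -> b = c.
Proof.
move=> E; have := E b; have := E c; rewrite /step !stripbb => Ec Eb.
have /stripP[cb _] : strip e b c by apply: contraT => /negbTE s; rewrite s in Ec; lia.
have /stripP[bc _] : strip e c b by apply: contraT => /negbTE s; rewrite s in Eb; lia.
lia.
Qed.

Lemma head_filter_iota (x0 : nat) (P : pred nat) a n : has P (iota a n) ->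
  let h := head x0 [seq h <- iota a n | P h] in
  [/\ a <= h < a + n, P h & forall g, a <= g < h -> ~~ P g].
Proof.
elim: n a => //= n IH a; case: (boolP (P a)) => /= [Pa _|nPa /IH[]].
  by split=> // [|g]; lia.
set h := head _ _ => hP Ph H; split=> // [|g gP]; first lia.
by have [->//|na] := eqVneq g a; apply: H; lia.
Qed.

Lemma heightP Y x (h := height Y x) : 0 < x ->
  [/\ 0 < h <= x, x - h = 0 \/ row_len Y x + h <= row_len Y (x - h)
    & forall g, 0 < g < h -> row_len Y (x - g) < row_len Y x + g].
Proof.
move=> x0; set P := fun h => (h == x) || (row_len Y x + h <= row_len Y (x - h)).
have hP : has P (iota 1 x).
  by apply/hasP; exists x; [rewrite mem_iota; lia | rewrite /P eqxx].
have [h1 h2 h3] := head_filter_iota x hP; rewrite -/(height Y x) -/h in h1 h2 h3.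
split; first by lia.
  by case/orP: h2 => [/eqP->|]; [left; rewrite subnn | right].
by move=> g gh; have := h3 g gh; rewrite negb_or -ltnNge => /andP[].
Qed.

(** Minimality of the height says that the rows of the strip above [b] have smaller state than [b].
    The row just above the strip, if any, has state at least that of [b] in [Y], hence strictly
    larger in [Z]: this is legality. *)
Lemma delete_stripP Y b : young Y -> corner Y b.+1 -> let Z := delete_strip Y b.+1 in
  [/\ young Z, legal (state Z) b & state Y =1 step (state Z) b].
Proof.
move=> yY /andP[/andP[_ bY] cb] Z.
rewrite /row_len /= in cb.
have [h1 h2 h3] := @heightP Y b.+1 isT.
(* Counted from 1, [b.+1 - h] is the blocking row (0 if there is none); counted from 0, the same
   number [a] is the top row of the strip. *)
set h := height Y b.+1 in h1 h2 h3 *; set a := b.+1 - h in h2.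
pose t := [seq row_len Y d - (b.+1 - h < d <= b.+1) | d <- iota 1 (size Y)].
have tE d : nth 0 t d = nth 0 Y d - (a <= d <= b).
  case: (ltnP d (size Y)) => dY; last by rewrite !nth_default // size_map size_iota.
  by rewrite (nth_map 0) ?size_iota // nth_iota // add1n.
have pos d : d <= b -> 0 < nth 0 Y d by rewrite young_pos //; lia.
have tH d : nth 0 t d.+1 <= nth 0 t d.
  rewrite !tE; have := young_nth d yY; have := pos d.
  have [->|nd] := eqVneq d b; first by lia.
  by case: (leqP a d) => ad; case: (leqP d b) => db; lia.
have ZE d : nth 0 Z d = nth 0 Y d - (a <= d <= b) by rewrite -tE; exact: nth_filter_pos.
have below c : a <= c < b -> state Y c < state Y b.
  move=> cP; have := h3 (b - c); rewrite /state /row_len (_ : (b.+1 - (b - c)).-1 = c) /=; lia.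
have above : a = 0 \/ state Y b <= state Y a.-1.
  case: h2 => h2; [by left | case: (posnP a) => a0; [by left | right]].
  by move: h2; rewrite /state /row_len /=; lia.
have sZ d : state Z d = state Y d - (a <= d <= b).
  by rewrite /state ZE; case: (boolP (a <= d <= b)) => dP; [have := pos d|]; lia.
have posS d : a <= d <= b -> 0 < state Y d by move=> dP; have := pos d; rewrite /state; lia.
have aE : a <= b by lia.
have stZ d : strip (state Z) b d = (a <= d <= b).
  apply/stripP/idP => [[db H]|dP]; last first.
    split=> [|c cP]; first lia.
    by rewrite !sZ; have := below c; have := posS c; lia.
  rewrite db andbT leqNgt; apply/negP => da.
  case: above => [a0|ab]; first lia.
  by have := H a.-1; rewrite !sZ; have := posS b; lia.
split; first exact: young_filter_pos.
  apply/legalP => c cb'; rewrite stZ => cP; rewrite !sZ.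
  case: (leqP a c) => ac; first by have := below c; have := posS c; lia.
  have -> : c = a.-1 by lia.
  by case: above => [a0|ab]; have := posS b; lia.
by move=> d; rewrite /step stZ sZ; case: (boolP (_ <= _ <= _)) => dP; have := posS d; lia.
Qed.

Lemma covers_step Y' Y : young Y -> covers Y' Y ->
  exists b, [/\ b < size Y, legal (state Y') b & state Y =1 step (state Y') b].
Proof.
move=> yY /hasP[[|b]]; rewrite mem_iota // => bY /andP[cb /eqP->].
by have [_ lb sb] := delete_stripP yY cb; exists b.
Qed.

(** Deleting the strip of the corner in row [b] undoes some legal step at [b], and by [step_inj]
    only [Y'] can result. *)
Lemma step_covers Y' Y b : young Y -> young Y' -> legal (state Y') b ->
  state Y =1 step (state Y') b -> covers Y' Y.
Proof.
move=> yY yY' lb E.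
have Eb := E b; rewrite /step stripbb /state in Eb.
have bY : b < size Y by rewrite -young_pos //; lia.
have cb : corner Y b.+1.
  rewrite /corner bY /row_len /=; have := E b.+1; rewrite /step strip_gt // /state.
  by have := young_nth b yY'; lia.
apply/hasP; exists b.+1; first by rewrite mem_iota; lia.
rewrite cb; apply/eqP; have [yZ lZ EZ] := delete_stripP yY cb.
apply: young_ext => // d; apply/eqP; rewrite -(eqn_add2r d); apply/eqP.
by apply: (step_inj lb lZ) => c; rewrite -E EZ.
Qed.

(** * Sequences of diagrams traced by words *)

Definition diagram (m : nat) (e : nat -> nat) : seq nat :=
  [seq k <- [seq e d - d | d <- iota 0 m] | k != 0].

(** These are the functions [state Y] for diagrams [Y] with at most [m] rows. *)
Definition good (m : nat) (e : nat -> nat) : Prop :=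
  [/\ flat e, forall d, d <= e d & forall d, m <= d -> e d = d].

Lemma good_id m : good m id.
Proof. by split. Qed.

Lemma good_step m e b : b < m -> good m e -> good m (step e b).
Proof.
move=> bm [fe ge oe]; split=> [|d|d md]; first exact: flat_step.
  by apply: leq_trans (ge d) (leq_addr _ _).
by rewrite /step strip_gt ?addn0 ?oe //; apply: leq_trans md.
Qed.

Lemma good_run m e w : all (fun b => b < m) w -> good m e -> good m (run e w).
Proof.
elim: w e => // b w IH e /andP[bm wm] ge.
by rewrite run_cons; apply: IH => //; apply: good_step.
Qed.

Lemma diagramP m e : good m e ->
  young (diagram m e) /\ forall d, nth 0 (diagram m e) d = e d - d.
Proof.
move=> [fe ge oe].
have E d : nth 0 [seq e d - d | d <- iota 0 m] d = e d - d.
  case: (ltnP d m) => dm; last by rewrite nth_default ?size_map ?size_iota // oe // subnn.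
  by rewrite (nth_map 0) ?size_iota // nth_iota.
have H d : nth 0 [seq e d - d | d <- iota 0 m] d.+1 <= nth 0 [seq e d - d | d <- iota 0 m] d.
  by rewrite !E; have := fe d; lia.
by split=> [|d]; [apply: young_filter_pos | rewrite nth_filter_pos].
Qed.

Lemma state_diagram m e : good m e -> state (diagram m e) =1 e.
Proof. by move=> ge d; rewrite /state (diagramP ge).2 subnK //; case: ge. Qed.

Lemma diagram_state m Y : young Y -> size Y <= m -> diagram m (state Y) = Y.
Proof.
move=> yY Ym; have gY : good m (state Y).
  split=> d; rewrite /state; first by have := young_nth d yY; lia.
    exact: leq_addl.
  by move=> md; rewrite nth_default //; apply: leq_trans md.
have [yD nD] := diagramP gY; apply: young_ext => // d.
by rewrite nD /state addnK.
Qed.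

Lemma eq_diagram m e1 e2 : e1 =1 e2 -> diagram m e1 = diagram m e2.
Proof. by move=> E; congr filter; apply: eq_map => d; rewrite E. Qed.

Lemma nth_delta m d : nth 0 (delta m) d = m - d.
Proof.
case: (ltnP d m) => dm; last by rewrite nth_default ?size_rev ?size_iota //; lia.
by rewrite nth_rev size_iota // nth_iota; lia.
Qed.

Lemma size_delta m : size (delta m) = m.
Proof. by rewrite size_rev size_iota. Qed.

Lemma young_delta m : young (delta m).
Proof.
apply: young_nthP => [|d]; first by rewrite mem_rev mem_iota.
by rewrite !nth_delta; lia.
Qed.

Lemma tamariP m Y : reflect (young Y /\ forall d, nth 0 Y d <= m - d) (tamari m.+1 Y).
Proof.
apply: (iffP andP) => -[yY H]; split=> //.
  move=> d; case: (ltnP d (size Y)) => dY; last by rewrite nth_default.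
  have /allP/(_ d.+1) := H; rewrite mem_iota /row_len /= nth_delta; apply; lia.
by apply/allP => -[|d] _; rewrite /row_len /= nth_delta ?(leq_trans (H 0)) ?H.
Qed.

Lemma tamari_size m Y : tamari m.+1 Y -> size Y <= m.
Proof.
move=> /tamariP[yY H]; rewrite leqNgt; apply/negP => mY.
by have := H m; rewrite subnn leqn0 eqn0Ngt young_pos // mY.
Qed.

Definition diagrams (m : nat) (e : nat -> nat) (w : seq nat) : seq (seq nat) :=
  [seq diagram m (run e (take r w)) | r <- iota 0 (size w).+1].

Arguments diagrams : simpl never.

Lemma diagrams_cons m e b w :
  diagrams m e (b :: w) = diagram m e :: diagrams m (step e b) w.
Proof. by rewrite /diagrams /= (iotaDl 1 1) /= -map_comp. Qed.

Lemma diagrams_behead m e w : diagrams m e w = diagram m e :: behead (diagrams m e w).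
Proof. by rewrite /diagrams /= take0. Qed.

Lemma size_diagrams m e w : size (diagrams m e w) = (size w).+1.
Proof. by rewrite size_map size_iota. Qed.

Lemma last_diagrams m e w Y : last Y (diagrams m e w) = diagram m (run e w).
Proof. by rewrite /diagrams -addn1 iotaD map_cat last_cat /= add0n take_size. Qed.

(** Two successive diagrams determine the end row between them, by [step_letter_inj]. *)
Lemma diagrams_inj m e w w' : good m e ->
  all (fun b => b < m) w -> all (fun b => b < m) w' ->
  diagrams m e w = diagrams m e w' -> w = w'.
Proof.
elim: w w' e => [|b w IH] [|b' w'] e ge //=; try by move=> _ _ /(congr1 size); rewrite !size_diagrams.
move=> /andP[bm wm] /andP[bm' wm']; rewrite !diagrams_cons => /eqP; rewrite eqseq_cons => /andP[_ /eqP E].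
have Eb : b = b'.
  apply: (@step_letter_inj e) => d; move: E.
  rewrite [LHS]diagrams_behead [RHS]diagrams_behead => /eqP.
  rewrite eqseq_cons => /andP[/eqP E' _].
  by rewrite -(state_diagram (good_step bm ge)) E' state_diagram //; apply: good_step.
by rewrite -Eb in E *; rewrite (IH w' _ (good_step bm ge)).
Qed.

Lemma path_diagrams m e w : good m e -> all (fun b => b < m) w -> valid e w ->
  path covers (diagram m e) (behead (diagrams m e w)).
Proof.
elim: w e => // b w IH e ge /andP[bm wm] /andP[lb vw].
have gs := good_step bm ge.
rewrite diagrams_cons -[behead _]/(diagrams m (step e b) w) diagrams_behead.
apply/andP; split; last exact: IH.
apply: (@step_covers _ _ b); try by case/diagramP: (gs).
- by case/diagramP: ge.
- by rewrite (eq_legal _ (state_diagram ge)).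
- by move=> d; rewrite state_diagram // (eq_step _ (state_diagram ge)).
Qed.

Lemma maximal_chain_diagrams m w : is_chain m w -> maximal_chain m.+1 (diagrams m id w).
Proof.
move=> cw; have /is_chainP[wm vw H] := cw.
have {}wm : all (fun b => b < m) w by apply/allP.
have tY : all (tamari m.+1) (diagrams m id w).
  apply/allP => Y /mapP[r _ ->].
  have gr : good m (run id (take r w)).
    by apply: good_run (good_id m); apply/allP => b /mem_take/(allP wm).
  have [y n] := diagramP gr; apply/tamariP; split=> // d; rewrite n.
  case: (ltnP d m) => dm; last by have [_ _ ->] := gr; rewrite ?subnn.
  by apply: leq_sub2r; rewrite -(H d (ltnW dm)) -{2}(cat_take_drop r w) run_cat run_ge.
have L := last_diagrams m id w [::]; have PP := path_diagrams (good_id m) wm vw.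
rewrite diagrams_behead in tY L *; change (last (diagram m id) (behead (diagrams m id w)) = diagram m (run id w)) in L.
rewrite /maximal_chain tY PP L.
have -> : diagram m id = [::].
  by apply/eqP; rewrite -[_ == _]negbK -has_filter; apply/hasPn => k /mapP[d _ ->]; rewrite subnn.
rewrite eqxx /=; apply/eqP.
have gw := good_run wm (good_id m); have [y n] := diagramP gw.
apply: young_ext => // [|d]; first exact: young_delta.
rewrite n nth_delta; case: (leqP d m) => dm; first by rewrite H.
by have [_ _ ->] := gw; lia.
Qed.

Lemma path_covers_diagrams m Y0 c : tamari m.+1 Y0 -> all (tamari m.+1) c ->
  path covers Y0 c ->
  exists w, [/\ all (fun b => b < m) w, valid (state Y0) w,
    diagrams m (state Y0) w = Y0 :: c & run (state Y0) w =1 state (last Y0 c)].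
Proof.
elim: c Y0 => [|Y c IH] Y0 t0 /=.
  exists [::]; split=> //; rewrite /diagrams /= /run /= diagram_state //.
    by case/tamariP: t0.
  exact: tamari_size.
move=> /andP[tY tc] /andP[cY pc].
have [w [wm vw Ew rw]] := IH Y tY tc pc.
have [yY _] := tamariP _ _ tY; have [y0 _] := tamariP _ _ t0.
have [b [bY lb sb]] := covers_step yY cY.
exists (b :: w); split.
- by rewrite /= wm andbT; apply: leq_trans bY (tamari_size tY).
- by rewrite /= lb -(eq_valid _ sb).
- rewrite diagrams_cons diagram_state ?tamari_size //; congr cons; rewrite -Ew.
  by apply: eq_map => r; apply: eq_diagram => d; apply: eq_run => c'; rewrite sb.
- by move=> d; rewrite run_cons -(eq_run _ sb) rw.
Qed.

Lemma diagrams_onto m c : maximal_chain m.+1 c ->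
  exists2 w, is_chain m w & diagrams m id w = c.
Proof.
case: c => // Y0 c /and4P[/andP[t0 tc] /eqP E0 pc /eqP lc].
have [w [wm vw Ew rw]] := path_covers_diagrams t0 tc pc.
have s0 : state Y0 =1 id by move=> d; rewrite /state E0 nth_nil.
exists w; last by rewrite -Ew; apply: eq_map => r; apply: eq_diagram => d; apply: eq_run => c'; rewrite s0.
apply/is_chainP; split; first exact/allP.
  by rewrite -(eq_valid _ s0).
by move=> d dm; rewrite -(eq_run _ s0) rw lc /state nth_delta /= subnK.
Qed.

(** * Tableaux as words *)

Lemma nth_diagrams m e w r : r <= size w ->
  nth [::] (diagrams m e w) r = diagram m (run e (take r w)).
Proof. by move=> rw; rewrite (nth_map 0) ?size_iota // nth_iota. Qed.

Lemma run_count e w d : run e w d =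
  e d + count (fun j => strip (run e (take j w)) (nth 0 w j) d) (iota 0 (size w)).
Proof.
elim: w e => [|b w IH] e; first by rewrite addn0.
by rewrite run_cons IH /= (iotaDl 1 0) count_map addnA.
Qed.

(** In a strictly increasing row the labels at most [r] form an initial segment. This translates
    conditions on labels into row lengths of restrictions. *)
Lemma nth_le_count R y r : sorted ltn R -> y < size R ->
  (nth 0 R y <= r) = (y < count (fun a => a <= r) R).
Proof.
elim: R y => //= x R IH y sR yR; have sR' := path_sorted sR.
have /allP xR : all (ltn x) R by apply: order_path_min sR; exact: ltn_trans.
case: (leqP x r) => xr /=.
  by case: y yR => //= y yR; rewrite IH.
rewrite add0n (_ : count _ R = 0).
  case: y yR => [|y] /= yR; first by rewrite leqNgt xr.
  by have := xR _ (mem_nth 0 yR); rewrite /=; lia.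
by apply/eqP; rewrite -leqn0 leqNgt -has_count; apply/hasPn => a /xR /=; lia.
Qed.

(** Together with the converse [nth_le_of_count]: weak increase down the columns means that all
    restrictions have weakly decreasing rows. *)
Lemma count_le_of_nth R S r : sorted ltn R -> sorted ltn S -> size S <= size R ->
  (forall y, y < size S -> nth 0 R y <= nth 0 S y) ->
  count (fun a => a <= r) S <= count (fun a => a <= r) R.
Proof.
move=> sR sS SR H; case Ey: (count _ S) => [//|y].
have yS : y < size S by rewrite -Ey count_size.
rewrite -nth_le_count //; last exact: leq_trans SR.
by apply: leq_trans (H y yS) _; rewrite nth_le_count // Ey.
Qed.

Lemma nth_le_of_count R S y : sorted ltn R -> sorted ltn S -> y < size S ->
  (forall r, count (fun a => a <= r) S <= count (fun a => a <= r) R) ->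
  nth 0 R y <= nth 0 S y.
Proof.
move=> sR sS yS H; have yc : y < count (fun a => a <= nth 0 S y) R.
  by apply: leq_trans (H _); rewrite -nth_le_count.
by rewrite nth_le_count // (leq_trans yc) // count_size.
Qed.

Lemma count_leqS R r : uniq R ->
  count (fun a => a <= r.+1) R = count (fun a => a <= r) R + (r.+1 \in R).
Proof.
move=> uR; rewrite -(count_uniq_mem _ uR) -count_predUI.
rewrite (_ : count (predI _ _) R = 0); last first.
  by rewrite -(count_pred0 R); apply: eq_count => a /=; case: eqP => [->|]; lia.
by rewrite addn0; apply: eq_count => a /=; rewrite leq_eqVlt orbC.
Qed.

Lemma eq_mem_of_count l R S : uniq R -> uniq S ->
  {subset R <= iota 1 l} -> {subset S <= iota 1 l} ->
  (forall r, r <= l -> count (fun a => a <= r) R = count (fun a => a <= r) S) -> R =i S.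
Proof.
move=> uR uS Rl Sl H [|r]; first by apply/idP/idP => [/Rl|/Sl]; rewrite mem_iota.
case: (ltnP r l) => rl; last by apply/idP/idP => [/Rl|/Sl]; rewrite mem_iota; lia.
have := H r.+1 rl; rewrite !count_leqS // (H r (ltnW rl)) => /addnI.
by case: (_ \in R); case: (_ \in S).
Qed.

(** Labels start at 1 and steps at 0, so label [r] belongs to step [r.-1]. *)
Definition tableau_row (w : seq nat) (d : nat) : seq nat :=
  [seq r <- iota 1 (size w) | strip (run id (take r.-1 w)) (nth 0 w r.-1) d].

Definition tableau_of (m : nat) (w : seq nat) : seq (seq nat) :=
  [seq tableau_row w d | d <- iota 0 m].

Lemma sorted_tableau_row w d : sorted ltn (tableau_row w d).
Proof. by apply: sorted_filter (iota_ltn_sorted _ _); exact: ltn_trans. Qed.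

Lemma uniq_tableau_row w d : uniq (tableau_row w d).
Proof. by rewrite filter_uniq ?iota_uniq. Qed.

Lemma mem_tableau_row w d j : j < size w ->
  (j.+1 \in tableau_row w d) = strip (run id (take j w)) (nth 0 w j) d.
Proof. by move=> jw; rewrite mem_filter mem_iota /= add1n !ltnS jw andbT. Qed.

Lemma count_tableau_row w d r : r <= size w ->
  count (fun a => a <= r) (tableau_row w d) = run id (take r w) d - d.
Proof.
move=> rw; rewrite run_count addKn size_takel //.
rewrite count_filter -{1}(subnKC rw) iotaD count_cat.
rewrite [X in _ + X](_ : _ = 0) ?addn0; last first.
  apply/eqP; rewrite -leqn0 leqNgt -has_count; apply/hasPn => a.
  by rewrite mem_iota /= => ar; rewrite negb_and; apply/orP; left; lia.
rewrite (iotaDl 1 0) count_map; apply: eq_in_count => j; rewrite mem_iota /= => jr.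
by rewrite add1n jr /= take_takel ?nth_take // ltnW.
Qed.

Lemma shape_restrict T r :
  shape (restrict T r) = [seq k <- [seq count (fun a => a <= r) R | R <- T] | k != 0].
Proof.
elim: T => //= R T IH; rewrite /restrict /= -size_filter size_eq0 -/(restrict T r).
by case: eqP => _ /=; rewrite IH // size_filter.
Qed.

Lemma shape_restrict_tableau m w r : r <= size w ->
  shape (restrict (tableau_of m w) r) = diagram m (run id (take r w)).
Proof.
move=> rw; rewrite shape_restrict /diagram -map_comp; congr filter.
by apply: eq_map => d /=; rewrite count_tableau_row.
Qed.

Definition chain_of_tableau (l : nat) (T : seq (seq nat)) : seq (seq nat) :=
  [seq shape (restrict T r) | r <- iota 0 l.+1].

Lemma chain_of_tableau_of m w :
  chain_of_tableau (size w) (tableau_of m w) = diagrams m id w.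
Proof.
by apply/eq_in_map => r; rewrite mem_iota /= add0n ltnS => /shape_restrict_tableau.
Qed.

Lemma nth_tableau_of m w d : d < m -> nth [::] (tableau_of m w) d = tableau_row w d.
Proof. by move=> dm; rewrite (nth_map 0) ?size_iota // nth_iota. Qed.

Lemma size_tableau_of m w : size (tableau_of m w) = m.
Proof. by rewrite size_map size_iota. Qed.

Lemma size_tableau_row m w d : is_chain m w -> d < m -> size (tableau_row w d) = m - d.
Proof.
move=> /is_chainP[_ _ H] dm.
rewrite -(H d (ltnW dm)) -{2}(take_size w) -count_tableau_row //.
apply/esym/eqP; rewrite -all_count; apply/allP => r.
by rewrite mem_filter mem_iota => /andP[_]; lia.
Qed.

Lemma nth_tableau_shape T d : nth 0 (shape T) d = size (nth [::] T d).
Proof.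
case: (ltnP d (size T)) => dT; first by rewrite (nth_map [::]).
by rewrite !nth_default // size_map.
Qed.

Lemma shape_tableau_of m w : is_chain m w -> shape (tableau_of m w) = delta m.
Proof.
move=> cw; apply: (@eq_from_nth _ 0) => [|d]; rewrite size_map size_tableau_of.
  by rewrite size_delta.
by move=> dm; rewrite nth_tableau_shape nth_tableau_of // (size_tableau_row cw) // nth_delta.
Qed.

Lemma mem_boxes T x y : ((x, y) \in boxes T) =
  (0 < x <= size T) && (0 < y <= size (nth [::] T x.-1)).
Proof.
rewrite /boxes; apply/allpairsPdep/andP => [[x' [y' [+ + [-> ->]]]]|[xT yT]].
  by rewrite !mem_iota /row_len nth_tableau_shape !add1n !ltnS.
by exists x, y; rewrite !mem_iota /row_len nth_tableau_shape !add1n !ltnS.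
Qed.

(** The default [[:: 0]] differs from [[::]], so the second condition also excludes an empty [c]. *)
Lemma maximal_chainP m c : maximal_chain m.+1 c <->
  [/\ all (tamari m.+1) c, head [:: 0] c = [::],
      forall i, i.+1 < size c -> covers (nth [::] c i) (nth [::] c i.+1)
    & last [:: 0] c = delta m].
Proof.
case: c => [|Y c]; first by split=> // -[].
rewrite /=; split=> [/and4P[tc /eqP Y0 pc /eqP lc]|[tc Y0 pc lc]].
  by split=> //; exact: (elimT (@sortedP _ covers (Y :: c) [::]) pc).
rewrite tc lc !eqxx Y0 eqxx andbT /= -Y0.
exact: (introT (@sortedP _ covers (Y :: c) [::]) pc).
Qed.

Lemma psi_tableau_of m w : is_chain m w -> psi_tableau (size w) (tableau_of m w).
Proof.
move=> cw; have /is_chainP[wm vw H] := cw.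
have wall : all (fun b => b < m) w by apply/allP.
have /maximal_chainP[_ _ cov _] := maximal_chain_diagrams cw.
apply/andP; split; last first.
  apply/allP => -[|r]; rewrite mem_iota // => rW; have rw : r < size w by lia.
  have := cov r; rewrite size_diagrams ltnS => /(_ rw).
  by rewrite !nth_diagrams ?(ltnW rw) // !shape_restrict_tableau // ltnW.
apply/and4P; split.
- by rewrite shape_tableau_of // young_delta.
- by apply/allP => R /mapP[d _ ->]; exact: sorted_tableau_row.
- apply/allP => -[x y] _; apply/implyP; rewrite mem_boxes size_tableau_of /label /=.
  case: x => [|x]; case: y => [|y]; rewrite ?andbF // => /andP[xm].
  rewrite !nth_tableau_of ?(ltnW xm) // => yS.
  apply: nth_le_of_count; rewrite ?sorted_tableau_row // => r.
  have [rw|rw] := leqP r (size w).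
    rewrite !count_tableau_row //.
    have := @flat_run id (take r w) (fun d => leqnn _) x.
    by have := run_ge id (take r w) x; rewrite /=; lia.
  have Er z : count (fun a => a <= r) (tableau_row w z) = size (tableau_row w z).
    apply/eqP; rewrite -all_count; apply/allP => a.
    by rewrite mem_filter mem_iota => /andP[_]; lia.
  by rewrite !Er !(size_tableau_row cw) ?(ltnW xm) //; lia.
- apply: uniq_perm; rewrite ?undup_uniq ?iota_uniq // => r; rewrite mem_undup.
  apply/flattenP/idP => [[R /mapP[d _ ->]]|]; first by rewrite mem_filter => /andP[].
  case: r => [|j]; rewrite mem_iota // => jW; have jw : j < size w by lia.
  have bm : nth 0 w j < m by apply/wm/mem_nth.
  exists (tableau_row w (nth 0 w j)); last by rewrite mem_tableau_row // stripbb.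
  by apply/mapP; exists (nth 0 w j); rewrite // mem_iota.
Qed.

Lemma tableau_of_inj m w w' : is_chain m w -> is_chain m w' -> size w = size w' ->
  tableau_of m w = tableau_of m w' -> w = w'.
Proof.
move=> /and3P[wm _ _] /and3P[wm' _ _] sw E; apply: (diagrams_inj (good_id m)) => //.
by rewrite -!chain_of_tableau_of sw E.
Qed.

Lemma restrict_nonincreasing l T r d : tableau l T ->
  count (fun a => a <= r) (nth [::] T d.+1) <= count (fun a => a <= r) (nth [::] T d).
Proof.
move=> /and4P[yT /allP sT /allP cT _].
case: (ltnP d.+1 (size T)) => dT; last by rewrite nth_default.
have sz : size (nth [::] T d.+1) <= size (nth [::] T d) by rewrite -!nth_tableau_shape young_nth.
apply: count_le_of_nth => //; try by apply/sT/mem_nth => //; apply: ltnW.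
move=> y yS; have := cT (d.+1, y.+1); rewrite mem_boxes /= (ltnW dT) (leq_trans yS sz) => /(_ isT).
by rewrite mem_boxes /= dT yS.
Qed.

Lemma mem_row l T d a : tableau l T -> a \in nth [::] T d -> a \in iota 1 l.
Proof.
move=> /and4P[_ _ _ /perm_mem E] aT; rewrite -E mem_undup; apply/flattenP.
exists (nth [::] T d) => //; apply: mem_nth; rewrite ltnNge; apply/negP => dT.
by rewrite nth_default in aT.
Qed.

Lemma nth_shape_restrict l T r d : tableau l T ->
  nth 0 (shape (restrict T r)) d = count (fun a => a <= r) (nth [::] T d).
Proof.
move=> tT; have E c : nth 0 [seq count (fun a => a <= r) R | R <- T] c =
    count (fun a => a <= r) (nth [::] T c).
  by case: (ltnP c (size T)) => cT; [rewrite (nth_map [::]) | rewrite !nth_default ?size_map].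
rewrite shape_restrict nth_filter_pos ?E // => c.
by rewrite !E (restrict_nonincreasing r c tT).
Qed.

Lemma young_shape_restrict l T r : tableau l T -> young (shape (restrict T r)).
Proof.
move=> tT; apply: young_nthP => [|d]; first by rewrite shape_restrict mem_filter.
by rewrite !(nth_shape_restrict _ _ tT) (restrict_nonincreasing r d tT).
Qed.

Lemma maximal_chain_of_tableau m l T : psi_tableau l T -> shape T = delta m ->
  maximal_chain m.+1 (chain_of_tableau l T).
Proof.
move=> /andP[tT /allP cT] shT; apply/maximal_chainP.
have nthc i : i < l.+1 -> nth [::] (chain_of_tableau l T) i = shape (restrict T i).
  by move=> il; rewrite (nth_map 0) ?size_iota // nth_iota.
split.
- apply/allP => Y /mapP[r _ ->]; apply/tamariP; split=> [|d].
    exact: young_shape_restrict tT.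
  by rewrite (nth_shape_restrict _ _ tT) -nth_delta -shT nth_tableau_shape count_size.
- rewrite -nth0 /= shape_restrict; apply/eqP; rewrite -[_ == _]negbK -has_filter.
  apply/hasPn => k /mapP[R /(nthP [::])[d _ <-] ->]; rewrite negbK -leqn0 leqNgt -has_count.
  by apply/hasPn => a /(mem_row tT); rewrite mem_iota; lia.
- move=> i; rewrite size_map size_iota ltnS => il.
  rewrite !nthc ?ltnS ?(ltnW il) //; apply: (cT i.+1); rewrite mem_iota; lia.
- rewrite -nth_last size_map size_iota /= (set_nth_default [::]) ?size_map ?size_iota //.
  rewrite nthc // -shT; apply: young_ext; first exact: young_shape_restrict tT.
    by case/and4P: tT.
  move=> d; rewrite (nth_shape_restrict _ _ tT) nth_tableau_shape; apply/eqP.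
  by rewrite -all_count; apply/allP => a /(mem_row tT); rewrite mem_iota; lia.
Qed.

(** The restrictions of [T] form a maximal chain, hence come from a word. Each row of [T] is
    strictly increasing, so it is determined by its numbers of labels at most [r], which are the row
    lengths along that chain. *)
Lemma tableau_of_onto m l T : psi_tableau l T -> shape T = delta m ->
  exists2 w, is_chain m w & size w = l /\ tableau_of m w = T.
Proof.
move=> pT shT; have tT : tableau l T by case/andP: pT.
have [w cw Ew] := diagrams_onto (maximal_chain_of_tableau pT shT).
have sw : size w = l.
  by have := congr1 size Ew; rewrite size_diagrams size_map size_iota => -[].
exists w => //; split=> //.
have sT : size T = m by rewrite -(size_map size T) -[map _ _]/(shape T) shT size_delta.
apply: (@eq_from_nth _ [::]) => [|d]; rewrite size_tableau_of // => dm.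
have sR : sorted ltn (nth [::] T d).
  by case/and4P: tT => _ /allP H _ _; apply/H/mem_nth; rewrite sT.
rewrite nth_tableau_of //; apply: (irr_sorted_eq ltn_trans ltnn) => //.
  exact: sorted_tableau_row.
apply: (@eq_mem_of_count l).
- exact: uniq_tableau_row.
- exact: (sorted_uniq ltn_trans ltnn).
- by move=> r; rewrite mem_filter sw => /andP[].
- by move=> r; exact: mem_row tT.
move=> r rl; rewrite count_tableau_row ?sw // -(nth_shape_restrict _ _ tT).
have := congr1 (fun c => nth [::] c r) Ew.
rewrite nth_diagrams ?sw // (nth_map 0) ?size_iota // nth_iota // => <-.
rewrite (diagramP (good_run _ (good_id m))).2 //.
by apply/allP => b /mem_take; case/is_chainP: cw => H _ _; apply: H.
Qed.

(** The end-box of the set lies in row [b.+1]. It is on the outer diagonal exactly when step [j]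
    completes that row, and the next row ends in a smaller label exactly when it was completed
    earlier. *)
Lemma plus_full_setE m w j : is_chain m w -> j < size w ->
  plus_full_set m.+1 (tableau_of m w) j.+1 = plus_at m w j.
Proof.
move=> cw jw; have /is_chainP[wm vw H] := cw.
set T := tableau_of m w; set b := nth 0 w j; set e := run id (take j w).
have bm : b < m by apply/wm/mem_nth.
have e'E : run id (take j.+1 w) =1 step e b.
  by move=> d; rewrite (take_nth 0 jw) -cats1 run_cat.
have ebm : (e b).+1 <= m.
  have := run_ge (run id (take j.+1 w)) (drop j.+1 w) b.
  by rewrite -run_cat cat_take_drop H ?(ltnW bm) // e'E /step stripbb addn1.
have lab (x y : nat) : ((x, y) \in label_set T j.+1) =
    [&& 0 < x <= m, 0 < y <= size (tableau_row w x.-1) & nth 0 (tableau_row w x.-1) y.-1 == j.+1].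
  rewrite mem_filter mem_boxes size_tableau_of /label /= andbC -andbA.
  by case: x => // x; case: (ltnP x m) => //= xm; rewrite !nth_tableau_of.
have inrow (x y : nat) : (x, y) \in label_set T j.+1 -> strip e b x.-1.
  by rewrite lab => /and3P[_]; case: y => // y yP /eqP Ey; rewrite -mem_tableau_row // -Ey mem_nth.
have rowin d : strip e b d -> exists y, (d.+1, y) \in label_set T j.+1.
  move=> s; have /stripP[db _] := s; rewrite -mem_tableau_row // in s.
  have /(nthP 0)[y yR Ey] := s; exists y.+1; rewrite lab /= yR Ey eqxx andbT; lia.
rewrite /plus_at /plus_from /= -/b -/e; apply/hasP/and3P => [[k] | [s0 /eqP e1 /eqP e2]].
  rewrite mem_iota => km /andP[/andP[/hasP[[x y] xyT /eqP/= x1] /andP[kT /allP kmax]] Hk].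
  have s0 : strip e b 0 by have := inrow _ _ xyT; rewrite x1.
  have kb : k = b.+1.
    have /stripP[+ _] := inrow _ _ kT.
    have [y' y'T] := rowin b (stripbb e b); have := kmax _ y'T; rewrite /=; lia.
  subst k; split=> //.
    have := kT; rewrite lab => /and3P[_ /= yP /eqP Ey].
    have : nth 0 (tableau_row w b) (m.+1 - b.+1).-1 <= j.+1 by rewrite Ey.
    rewrite nth_le_count ?sorted_tableau_row //; last lia.
    by rewrite count_tableau_row // e'E /step stripbb; lia.
  case/orP: Hk => [/eqP Ek|/andP[bk]].
    (* For the lowest row the last condition is automatic, as row [m] never moves. *)
    have -> : b.+1 = m by [].
    by rewrite /e (@run_out _ _ m) //; apply/allP => c /mem_take /wm.
  have bm1 : b.+1 < m by lia.
  rewrite /label /= nth_tableau_of // ltnS nth_le_count ?sorted_tableau_row //; last first.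
    by rewrite (size_tableau_row cw) //; lia.
  rewrite count_tableau_row ?(ltnW jw) // -/e => He.
  have : e b.+1 <= m; last by lia.
  have := run_ge e (drop j w) b.+1; rewrite -run_cat cat_take_drop H //; lia.
exists b.+1; first by rewrite mem_iota; lia.
have szb : size (tableau_row w b) = m - b by rewrite (size_tableau_row cw).
have last_b : nth 0 (tableau_row w b) (m - b).-1 = j.+1.
  have leE r := nth_le_count r (sorted_tableau_row w b) (_ : (m - b).-1 < _).
  apply/eqP; rewrite eqn_leq [j.+1 <= _]ltnNge !leE ?szb; try lia.
  rewrite !count_tableau_row ?(ltnW jw) // -/e e'E /step stripbb; lia.
have eb : (b.+1, m.+1 - b.+1) \in label_set T j.+1.
  rewrite lab /= szb subSS last_b eqxx; lia.
apply/andP; split.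
  apply/andP; split; first by have [y yT] := rowin 0 s0; apply/hasP; exists (1, y).
  rewrite /is_end_box eb; apply/allP => -[x y] /[dup] /inrow /stripP[xb _].
  rewrite lab /=; lia.
case: (eqVneq b.+1 m) => [_|bm']; first by rewrite orTb.
have bm1 : b.+1 < m by lia.
apply/orP; right; rewrite subn2 /= -ltnS prednK ?bm1; last by lia.
rewrite /label /= nth_tableau_of // ltnS nth_le_count ?sorted_tableau_row //; last first.
  by rewrite (size_tableau_row cw) //; lia.
by rewrite count_tableau_row ?(ltnW jw) // -/e; lia.
Qed.

(** * Transfer to the finite types *)

Lemma map_onto (S : Type) (T : eqType) (f : S -> T) (s : seq T) :
  (forall x, x \in s -> exists a, f a = x) -> exists t, map f t = s.
Proof.
elim: s => [|x s IH] H; first by exists [::].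
have [a Ea] := H x (mem_head _ _).
have [|t Et] := IH; first by move=> y ys; apply: H; rewrite inE ys orbT.
by exists (a :: t); rewrite /= Ea Et.
Qed.

Lemma bseq_onto N (S : Type) (T : eqType) (f : S -> T) (s : seq T) : size s <= N ->
  (forall x, x \in s -> exists a, f a = x) -> exists t : {bseq N of S}, map f t = s.
Proof.
move=> sN /map_onto[t Et]; have tN : size t <= N by rewrite -(size_map f) Et.
by exists (Bseq tN).
Qed.

Lemma ord_onto k x : x < k -> exists a : 'I_k, val a = x.
Proof. by move=> xk; exists (Ordinal xk). Qed.

Lemma diagram_val_inj n : injective (@diagram_val n).
Proof. by move=> Y Z /(inj_map val_inj)/val_inj. Qed.

Lemma tableau_val_inj n l : injective (@tableau_val n l).
Proof.
by move=> T U /inj_map h; apply/val_inj/h => R S /(inj_map val_inj)/val_inj.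
Qed.

Lemma diagram_val_onto m Y : tamari m.+1 Y -> exists D : {bseq m.+1 of 'I_m.+1}, diagram_val D = Y.
Proof.
move=> tY; apply: bseq_onto; first exact: leqW (tamari_size tY).
move=> x /(nthP 0)[d _ <-]; apply: ord_onto; case/tamariP: tY => _ /(_ d) h.
by rewrite ltnS (leq_trans h) ?leq_subr.
Qed.

(** Makes the length part of the predicate, since plain sequences do not carry it in their type. *)
Lemma eq_card_sized (A : finType) (X : eqType) (f : A -> seq X) k (P : pred (seq X)) :
  (forall a, size (f a) = k) ->
  #|[set a | (size (f a) == k) && P (f a)]| = #|[set a | P (f a)]|.
Proof. by move=> fk; apply: eq_card => a; rewrite !inE fk eqxx. Qed.

Lemma card_maximal_chains m l :
  #|maximal_chains m.+1 l| = #|[set w : l.-tuple 'I_m | is_chain m (word_val w)]|.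
Proof.
pose f' (c : l.+1.-tuple {bseq m.+1 of 'I_m.+1}) := [seq diagram_val Y | Y <- val c].
have sf' c : size (f' c) = l.+1 by rewrite size_map size_tuple.
rewrite -(eq_card_sized (@is_chain m) (@size_word_val l m)).
rewrite -[LHS](eq_card_sized (maximal_chain m.+1) sf'); symmetry.
apply: (@card_transfer _ _ _ _ (@word_val l m) f'
  (fun w => (size w == l) && is_chain m w)
  (fun c => (size c == l.+1) && maximal_chain m.+1 c) (diagrams m id)).
- exact: word_val_inj.
- by move=> c d /(inj_map (@diagram_val_inj _))/val_inj.
- by move=> w /andP[/eqP sw cw]; apply: word_val_onto.
- move=> c /andP[/eqP sc /maximal_chainP[/allP tc _ _ _]].
  have [t Et] : exists t, map (@diagram_val m.+1) t = c.
    by apply: map_onto => Y /tc; apply: diagram_val_onto.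
  have st : size t == l.+1 by rewrite -sc -Et size_map.
  by exists (Tuple st).
- by move=> w /andP[/eqP sw cw]; rewrite size_diagrams sw eqxx maximal_chain_diagrams.
- move=> w w' /andP[_ /and3P[wm _ _]] /andP[_ /and3P[wm' _ _]].
  exact: diagrams_inj (good_id m) wm wm'.
- move=> c /andP[/eqP sc /diagrams_onto[w cw Ew]]; exists w => //.
  by rewrite cw andbT -eqSS -(size_diagrams m id) Ew sc.
Qed.

(** The predicates [N] and [N'] let one bijection count both [Cset] and [Nset]. *)
Lemma card_tableaux m l (N : pred (seq nat)) (N' : pred (seq (seq nat))) :
  (forall w, size w = l -> is_chain m w -> N' (tableau_of m w) = N w) ->
  #|[set T : {bseq m.+1 of {bseq m.+1 of 'I_l.+1}} |
      [&& psi_tableau l (tableau_val T), shape (tableau_val T) == delta m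
        & N' (tableau_val T)]]|
  = #|[set w : l.-tuple 'I_m | is_chain m (word_val w) && N (word_val w)]|.
Proof.
move=> NN'.
rewrite -(eq_card_sized (fun w => is_chain m w && N w) (@size_word_val l m)); symmetry.
apply: (@card_transfer _ _ _ _ (@word_val l m) (@tableau_val m.+1 l)
  (fun w => (size w == l) && (is_chain m w && N w))
  (fun T => [&& psi_tableau l T, shape T == delta m & N' T]) (tableau_of m)).
- exact: word_val_inj.
- exact: tableau_val_inj.
- by move=> w /and3P[/eqP sw cw _]; apply: word_val_onto.
- move=> T /and3P[/andP[tT _] /eqP shT _].
  have sT : size T = m by rewrite -(size_delta m) -shT size_map.
  apply: bseq_onto; rewrite ?sT // => R /(nthP [::])[d dT <-].
  apply: bseq_onto; first by rewrite -nth_tableau_shape shT nth_delta leqW ?leq_subr.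
  by move=> a /(mem_row tT); rewrite mem_iota => aP; apply: ord_onto; lia.
- move=> w /and3P[/eqP sw cw Nw]; rewrite NN' // Nw shape_tableau_of // eqxx andbT.
  by rewrite -sw psi_tableau_of.
- move=> w w' /and3P[/eqP sw cw _] /and3P[/eqP sw' cw' _].
  by apply: tableau_of_inj; rewrite ?sw.
- move=> T /and3P[pT /eqP shT NT]; have [w cw [sw Ew]] := tableau_of_onto pT shT.
  by exists w => //; rewrite sw eqxx cw /= -NN' // Ew.
Qed.

Lemma addniE (s m : nat) : addni m.+1 (s%:Z - 1)%R = m + s.
Proof. by rewrite /addni; lia. Qed.

Lemma card_Cset (s m : nat) : #|Cset (s%:Z - 1)%R m.+1| = num_chains s m.
Proof.
rewrite /Cset addniE /num_chains.
have := @card_tableaux m (m + s) predT predT (fun _ _ _ => erefl).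
by under eq_finset do rewrite andbT; under [in RHS]eq_finset do rewrite andbT.
Qed.

Lemma card_Nset (s m : nat) : #|Nset (s%:Z - 1)%R m.+1| = num_plus_free s m.
Proof.
rewrite /Nset /Cset addniE /num_plus_free /chains_plus.
rewrite -(@card_tableaux m (m + s) (fun w => num_plus m w == 0)
  (fun T => all (fun r => ~~ plus_full_set m.+1 T r) (iota 1 (m + s)))).
  by apply: eq_card => T; rewrite !inE andbA.
move=> w sw cw; rewrite /num_plus sw -leqn0 leqNgt -has_count -all_predC.
rewrite (iotaDl 1 0) all_map; apply: eq_in_all => j; rewrite mem_iota add0n => /andP[_ jl].
by rewrite /= add1n plus_full_setE ?sw.
Qed.

(** * Polynomiality and inversion *)

Import Order.TTheory GRing.Theory Num.Theory.
Local Open Scope ring_scope.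

(** [mul_bin_bin] extracts ['C(m + s, k + s)], and what remains is the expansion of
    [(-1 + 1) ^+ (m - k)]. *)
Lemma alternating_bin_sum s m k : (k <= m)%N ->
  \sum_(j < m.+1) (-1) ^+ (m - j) * ('C(m + s, j + s) * 'C(j + s, k + s))%:Z
    = (k == m)%:Z.
Proof.
move=> km.
pose F j : int := (-1) ^+ (m - j) * ('C(m + s, j + s) * 'C(j + s, k + s))%:Z.
rewrite -(big_mkord xpredT F) (big_cat_nat (n := k)) //=; last exact: leqW.
rewrite big_nat_cond big1 ?add0r; last first.
  by move=> j /andP[/andP[_ jk] _]; rewrite /F (bin_small (_ : j + s < k + s)%N) ?muln0 ?mulr0 ?ltn_add2r.
rewrite -{1}[k]add0n big_addn big_mkord subSn //.
transitivity ('C(m + s, k + s)%:Z * (-1 + 1) ^+ (m - k) : int).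
  rewrite exprDn mulr_sumr; apply: eq_bigr => i _; rewrite /F.
  have im : (i <= m - k)%N by rewrite -ltnS.
  rewrite mul_bin_bin; [|lia|lia].
  rewrite !subnDr (addnK k i) expr1n mulr1 PoszM mulrCA -mulr_natr natz.
  by rewrite (_ : m - (i + k) = m - k - i)%N //; lia.
rewrite addNr expr0n subn_eq0; case: ltngtP km => // [km|->] _.
  by rewrite mulr0.
by rewrite binn mulr1.
Qed.

Lemma num_plus_free_inversion s m :
  (num_plus_free s m)%:Z =
    \sum_(j < m.+1) (-1) ^+ (m - j) * 'C(m + s, j + s)%:Z * (num_chains s j)%:Z.
Proof.
(* The range is extended to [m] by vanishing binomials, so that the two sums can be exchanged. *)
have E (j : 'I_m.+1) : (num_chains s j)%:Z =
    \sum_(k < m.+1) ('C(j + s, k + s) * num_plus_free s k)%:Z.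
  transitivity (\sum_(k < m.+1) 'C(j + s, k + s) * num_plus_free s k)%N%:Z.
    congr Posz; rewrite num_chains_sum.
    pose F k := ('C(j + s, k + s) * num_plus_free s k)%N.
    rewrite -!(big_mkord xpredT F) [RHS](big_cat_nat (n := j.+1)) //= ?ltn_ord //.
    rewrite [X in (_ + X)%N]big_nat_cond [X in (_ + X)%N]big1 ?addn0 //.
    by move=> k /andP[/andP[jk _] _]; rewrite /F bin_small ?ltn_add2r.
  by rewrite -natz natr_sum; apply: eq_bigr => k _; rewrite natz.
transitivity (\sum_(k < m.+1) (num_plus_free s k)%:Z * ((k : nat) == m)%:Z).
  rewrite big_ord_recr /= eqxx mulr1 big1 ?add0r // => k _.
  by rewrite ltn_eqF ?mulr0.
under [RHS]eq_bigr do rewrite E mulr_sumr.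
rewrite exchange_big /=; apply: eq_bigr => k _.
rewrite -(@alternating_bin_sum s m k) ?mulr_sumr; last by rewrite -ltnS.
by apply: eq_bigr => j _; rewrite !PoszM; ring.
Qed.

Definition ffact_poly (k : nat) : {poly rat} := \prod_(j < k) ('X - j%:R%:P).

Lemma horner_ffact_poly n k : (ffact_poly k).[n%:R] = (n ^_ k)%:R.
Proof.
rewrite /ffact_poly; elim: k => [|k IH]; first by rewrite big_ord0 hornerC.
rewrite big_ord_recr hornerM IH hornerXsubC ffactnSr natrM.
case: (leqP k n) => kn; first by rewrite natrB.
by rewrite ffact_small // !mul0r.
Qed.

Lemma size_ffact_poly k : size (ffact_poly k) = k.+1.
Proof. by rewrite size_prod_XsubC /index_enum -enumT size_enum_ord. Qed.

(** The summand [j] is a binomial of degree [j + s] in [m]; the last one, [j = s.*2], alone has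
    degree [3 * s]. *)
Lemma num_chains_poly s : exists p : {poly rat}, size p = (3 * s).+1 /\
  forall m, (num_chains s m)%:R = p.[m.+1%:R].
Proof.
(* The variable stands for [m.+1], so [q] takes the value [m + s]. *)
pose q := 'X + (s%:R - 1)%:P : {poly rat}.
have szq : size q = 2 by rewrite size_XaddC.
pose t j : {poly rat} := ((num_plus_free s j)%:R / (j + s)`!%:R) *: (ffact_poly (j + s) \Po q).
have szt j : (size (t j) <= (j + s).+1)%N.
  by apply: leq_trans (size_scale_leq _ _) _; rewrite size_comp_poly2 ?size_ffact_poly.
exists (\sum_(j < s.*2.+1) t j); split.
  rewrite big_ord_recr /= addrC size_polyDl.
    rewrite size_scale; first by rewrite size_comp_poly2 // size_ffact_poly; lia.
    by rewrite mulf_neq0 ?invr_neq0 // pnatr_eq0 -lt0n ?fact_gt0 ?num_plus_free_pos.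
  rewrite size_scale; last first.
    by rewrite mulf_neq0 ?invr_neq0 // pnatr_eq0 -lt0n ?fact_gt0 ?num_plus_free_pos.
  rewrite size_comp_poly2 // size_ffact_poly ltnS.
  apply: leq_trans (size_sum _ _ _) _; apply/bigmax_leqP => j _.
  by apply: leq_trans (szt j) _; rewrite -addSn leq_add2r.
move=> m; rewrite num_chains_sum_truncated natr_sum horner_sum.
apply: eq_bigr => j _; rewrite hornerZ horner_comp /q hornerD hornerX hornerC.
rewrite (_ : _ + _ = (m + s)%:R); last by rewrite -natr1 natrD; ring.
rewrite horner_ffact_poly -bin_ffact !natrM.
have : (j + s)`!%:R != 0 :> rat by rewrite pnatr_eq0 -lt0n fact_gt0.
by move: (_`!%:R) ('C(_, _)%:R) (num_plus_free s j)%:R => x y z x0; field.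
Qed.

Theorem theorem5p9 (i : int) (hi : -1 <= i) :
  [/\ (forall n : nat, (1 <= n)%N ->
         #|maximal_chains n (addni n i)| = #|Cset i n| /\
         #|Cset i n|
           = (\sum_(1 <= t < (absz (2 * i + 3)%R).+1)
                'C(addni n i, addni t i) * #|Nset i t|)%N),
      (exists p : {poly rat},
         (size p)%:Z = 3 * i + 3 + 1 /\
         forall n : nat, (1 <= n)%N -> #|Cset i n|%:R = p.[n%:R])
    & (forall n : nat, (1 <= n)%N -> n%:Z <= 2 * i + 3 ->
         #|Nset i n|%:Z
           = \sum_(1 <= t < n.+1)
               (-1) ^+ (n - t) * 'C(addni n i, addni t i)%:Z * #|Cset i t|%:Z)].
Proof.
have [s ->] : exists s : nat, i = s%:Z - 1 by exists (absz (i + 1)); lia.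
have -> : absz (2 * (s%:Z - 1) + 3) = s.*2.+1 by lia.
split.
- case=> // m _; rewrite card_Cset addniE card_maximal_chains; split=> //.
  rewrite num_chains_sum_truncated big_add1 big_mkord.
  by apply: eq_bigr => j _; rewrite card_Nset addniE.
- have [p [szp pE]] := num_chains_poly s; exists p; split; first by rewrite szp; lia.
  by case=> // m _; rewrite card_Cset pE.
- case=> // m _ _; rewrite card_Nset num_plus_free_inversion big_add1 big_mkord.
  by apply: eq_bigr => j _; rewrite card_Cset !addniE subSS.
Qed.
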